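(* Let $d\ge 1$, $n\ge 1$, and let $\xi_1,\dots,\xi_n$ be independent identically distributed random vectors in $\mathbb{R}^d$ whose distribution is centrally symmetric (i.e. $\xi_1\stackrel{d}{=}-\xi_1$) and satisfies $\mathbb{P}[\xi_1\in H]=0$ for every affine hyperplane $H\subset\mathbb{R}^d$. Let $S_k=\xi_1+\dots+\xi_k$ for $1\le k\le n$. Then $$\mathbb{P}[0\notin \mathrm{Conv}(S_1,S_2,\dots,S_n)]=\frac{2}{2^n n!}\sum_{k=1}^{\lceil d/2\rceil} B(n,d-2k+1),$$ where $B(n,k)$ are the coefficients defined by $(t+1)(t+3)\cdots(t+2n-1)=\sum_{k=0}^n B(n,k)t^k$ (with $B(n,k)=0$ for $k\notin\{0,\dots,n\}$).
   Context: $\mathrm{Conv}$ denotes the convex hull. *)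

(* Defs.v *)
From HB Require Import structures.
From mathcomp Require Import all_boot all_order all_algebra.
From mathcomp Require Import all_classical all_reals all_analysis.
Set Implicit Arguments. Unset Strict Implicit. Unset Printing Implicit Defensive.
Import Order.TTheory GRing.Theory Num.Theory.
Local Open Scope classical_set_scope.
Local Open Scope ring_scope.

(* Borel sigma-algebra on R^d = 'rV[R]_d : generated by the coordinate
   preimages of Borel subsets of R (product sigma-algebra = Borel on R^d). *)
Definition coord_preimages (R : realType) (d : nat) : set (set 'rV[R]_d) :=
  [set B | exists (j : 'I_d) (A : set R), measurable A /\
           B = (fun v : 'rV[R]_d => v ord0 j) @^-1` A].

Definition Rd_borel (R : realType) (d : nat) : set (set 'rV[R]_d) :=
  smallest (sigma_algebra setT) (@coord_preimages R d).

Definition random_vector d' (T : measurableType d') (R : realType) (d : nat)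
  (X : T -> 'rV[R]_d) : Prop :=
  forall j : 'I_d, measurable_fun setT (fun w => X w ord0 j).

Definition independent_vectors d' (T : measurableType d') (R : realType)
  (P : probability T R) (d n : nat) (X : 'I_n -> T -> 'rV[R]_d) : Prop :=
  forall B : 'I_n -> set 'rV[R]_d, (forall i, @Rd_borel R d (B i)) ->
    P (\bigcap_(i in [set: 'I_n]) (X i @^-1` B i)) =
    (\prod_(i < n) P (X i @^-1` B i))%E.

Definition same_distribution d' (T : measurableType d') (R : realType)
  (P : probability T R) (d : nat) (X Y : T -> 'rV[R]_d) : Prop :=
  forall B : set 'rV[R]_d, @Rd_borel R d B -> P (X @^-1` B) = P (Y @^-1` B).

Definition affine_hyperplane (R : realType) (d : nat) (H : set 'rV[R]_d) : Prop :=
  exists (a : 'rV[R]_d) (c : R), a != 0 /\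
    H = [set x | \sum_(j < d) a ord0 j * x ord0 j = c].

Definition in_conv_hull (R : realType) (d n : nat) (p : 'I_n -> 'rV[R]_d)
  (x : 'rV[R]_d) : Prop :=
  exists l : 'I_n -> R, (forall k, 0 <= l k) /\ \sum_(k < n) l k = 1 /\
    \sum_(k < n) l k *: p k = x.

Definition Bcoef (n k : nat) : int :=
  (\prod_(i < n) ('X + ((2 * i + 1)%:R)%:P) : {poly int})`_k.

(* Main.v *)
(** Abel summation turns a vanishing convex combination of the partial sums of
    a signed rearrangement [(eps_i xi_(sigma i))] into a non-zero element of the
    space [K] of linear relations between the [xi_i] lying in the closed Weyl
    chamber of type B attached to [(sigma, eps)].  Almost surely no rational
    linear relation degenerates further than it must, so [K] is in general
    position: it meets a closed chamber outside 0 exactly when it meets the open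
    one, and the number of chambers it meets depends on [n] and [d] only.
    Deletion-restriction, together with supersolvability of the reflection
    arrangement, gives for this number the recursion [rho], which matches
    [B(n+1,k) = (2n+1) B(n,k) + B(n,k-1)].  As the law of [(xi_i)] is invariant
    under the [2^n n!] signed permutations, averaging gives the probability.
    The event is measurable because, by Gordan's alternative, it is a countable
    union over integer vectors [z] of the events [forall k, <z, S_k> > 0]. *)
Require Import Defs.
From HB Require Import structures.
From mathcomp Require Import all_boot all_order all_algebra.
From mathcomp Require Import fingroup perm.
From mathcomp Require Import all_classical all_reals all_analysis.
From mathcomp Require Import measurable_realfun ring lra zify.
Set Implicit Arguments. Unset Strict Implicit. Unset Printing Implicit Defensive.
Import Order.TTheory GRing.Theory Num.Theory.
Import numFieldNormedType.Exports.
Local Open Scope classical_set_scope.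
Local Open Scope ring_scope.

(** * Regions of hyperplane arrangements *)

(** All walls are rational forms, so general position is tested against rational subspaces:
    countably many conditions, each almost sure, and stable under an invertible rational change of
    basis. Restricting to a wall adds one rational constraint; hence the counting induction carries
    a rational matrix [W] of constraints and controls the dimension of the restricted space by a
    rank formula. Chambers are counted as realised sign vectors, for which deletion-restriction is
    elementary, and are matched with signed permutations afterwards.

    The factor 2 is a matter of parity. The product (t+1)(t+3)...(t+2n-1) is 2^n n! at t = 1 and 0
    at t = -1, so the coefficients of each parity add up to 2^(n-1) n!. The chambers met by [K]
    number twice the sum of B(n,d+1), B(n,d+3), ..., hence the chambers missed number twice the sum
    of B(n,d-1), B(n,d-3), .... *)

Definition nclass (V : Type) (F : finType) (X : V -> Prop) (phi : V -> F) : nat :=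
  #|[pred s : F | `[< exists2 x, X x & phi x = s >]]|.

(** Choosing a point in each [psi]-class and taking its [phi]-value is injective, as [phi] is at
    least as fine as [psi] on [Y]. *)
Lemma nclass_le (V : Type) (F G : finType) (X Y : V -> Prop) (phi : V -> F)
    (psi : V -> G) :
  (forall x, Y x -> X x) ->
  (forall x y, Y x -> Y y -> phi x = phi y -> psi x = psi y) ->
  (nclass Y psi <= nclass X phi)%N.
Proof.
move=> YX phipsi; rewrite /nclass.
have [/eqP -> //|/pred0Pn[t0 /= /asboolP[x0 _ _]]] := boolP (pred0b [pred s : G | `[< exists2 x, Y x & psi x = s >]]).
have /choice[w wP] : forall t, exists y, (exists2 x, Y x & psi x = t) -> Y y /\ psi y = t.
  by move=> t; have [[x Yx xt]|nt] := pselect (exists2 x, Y x & psi x = t);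
    [exists x|exists x0].
rewrite -(card_in_image (f := fun t => phi (w t))); last first.
  move=> s t /asboolP/wP[Ys es] /asboolP/wP[Yt et] e; rewrite -es -et.
  by apply: phipsi.
apply/subset_leq_card/fintype.subsetP => s /fintype.imageP[t /asboolP/wP[Yt _] ->].
by apply/asboolP; exists (w t) => //; apply: YX.
Qed.

Lemma nclass_eq (V : Type) (F G : finType) (X Y : V -> Prop) (phi : V -> F)
    (psi : V -> G) :
  (forall x, X x <-> Y x) ->
  (forall x y, X x -> X y -> phi x = phi y <-> psi x = psi y) ->
  nclass X phi = nclass Y psi.
Proof.
move=> XY e; apply/eqP; rewrite eqn_leq; apply/andP; split; apply: nclass_le.
- by move=> x /XY.
- by move=> x y Xx Xy /e; apply.
- by move=> x /XY.
- by move=> x y /XY Xx /XY Xy /e; apply.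
Qed.

(** Each value of [phi] occurs with one or two booleans; the second summand counts the values that
    occur with both. *)
Lemma nclass_bool_pair (V : Type) (F : finType) (X : V -> Prop) (b : V -> bool)
    (phi : V -> F) :
  nclass X (fun x => (b x, phi x)) =
    (nclass X phi + nclass (fun x => (exists2 y, X y & b y /\ phi y = phi x) /\
                              (exists2 y, X y & ~~ b y /\ phi y = phi x)) phi)%N.
Proof.
rewrite /nclass -!sum1_card.
rewrite big_mkcond (eq_bigr (fun p => if `[< exists2 x, X x & (b x, phi x) = (p.1, p.2) >]
  then 1 else 0)%N); last by case.
rewrite -(pair_bigA _ (fun c s => if `[< exists2 x, X x & (b x, phi x) = (c, s) >]
  then 1 else 0)%N) /= big_bool /=.
rewrite [X in (_ = X + _)%N]big_mkcond [X in (_ = _ + X)%N]big_mkcond -!big_split /=.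
apply: eq_bigr => s _; rewrite !inE.
set T := `[< exists2 x, X x & (b x, phi x) = (true, s) >].
set N := `[< exists2 x, X x & (b x, phi x) = (false, s) >].
have -> : `[< exists2 x, X x & phi x = s >] = T || N.
  apply/asboolP/orP.
    move=> [x Xx es]; case bx : (b x); [left|right]; apply/asboolP;
    by exists x => //; rewrite bx es.
  by case=> /asboolP[x Xx [_ es]]; exists x.
set C := `[< _ >]; have -> : C = T && N.
  apply/asboolP/andP.
    move=> [x [[y Xy [byt e]] [z Xz [bzf e']]] es]; split; apply/asboolP.
      by exists y => //; rewrite byt e es.
    by exists z => //; rewrite (negbTE bzf) e' es.
  move=> [/asboolP[y Xy [bt e]] /asboolP[z Xz [bf e']]]; exists y => //.
  split; first by exists y.
  by exists z => //; rewrite bf e e'.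
by case: T; case: N.
Qed.

(** The perturbation tool used throughout: a strict inequality, scaled up, absorbs any finite family
    of errors. *)
Lemma large_multiple (R : realFieldType) (I : finType) (f g : I -> R) :
  exists2 N : R, 0 < N & forall i, 0 < f i -> 0 < N * f i + g i.
Proof.
(* Terms with [f i = 0] vanish, since division by zero is 0; the 1 makes the final inequality
   strict. *)
exists (1 + \sum_i `|g i / f i|).
  by rewrite ltr_wpDr// sumr_ge0.
move=> i fi0.
have h : `|g i / f i| <= \sum_i `|g i / f i|.
  by rewrite (bigD1 i)//= lerDl sumr_ge0.
have e : `|g i| = `|g i / f i| * f i.
  by rewrite normrM normfV (gtr0_norm fi0) divfK// gt_eqF.
have : - `|g i| <= g i by rewrite lerNl -normrN ler_norm.
have : `|g i / f i| * f i <= (\sum_i `|g i / f i|) * f i by rewrite ler_pM2r.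
rewrite -e => h1 h2; rewrite mulrDl mul1r.
by rewrite -addrA ltr_wpDr//; lra.
Qed.

Definition ev (R : realFieldType) (n : nat) (f : 'rV[rat]_n) (x : 'rV[R]_n) : R :=
  \sum_(j < n) ratr (f 0 j) * x 0 j.

Lemma evDr (R : realFieldType) (n : nat) (f : 'rV[rat]_n) (x y : 'rV[R]_n) :
  ev f (x + y) = ev f x + ev f y.
Proof. by rewrite /ev -big_split; apply: eq_bigr => j _; rewrite mxE mulrDr. Qed.

Lemma evZr (R : realFieldType) (n : nat) (f : 'rV[rat]_n) (a : R) (x : 'rV[R]_n) :
  ev f (a *: x) = a * ev f x.
Proof. by rewrite /ev mulr_sumr; apply: eq_bigr => j _; rewrite mxE mulrCA. Qed.

Lemma evDl (R : realFieldType) (n : nat) (f g : 'rV[rat]_n) (x : 'rV[R]_n) :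
  ev (f + g) x = ev f x + ev g x.
Proof.
by rewrite /ev -big_split; apply: eq_bigr => j _; rewrite mxE rmorphD mulrDl.
Qed.

Lemma evZl (R : realFieldType) (n : nat) (c : rat) (f : 'rV[rat]_n) (x : 'rV[R]_n) :
  ev (c *: f) x = ratr c * ev f x.
Proof.
by rewrite /ev mulr_sumr; apply: eq_bigr => j _; rewrite mxE rmorphM mulrA.
Qed.

Lemma evNl (R : realFieldType) (n : nat) (f : 'rV[rat]_n) (x : 'rV[R]_n) :
  ev (- f) x = - ev f x.
Proof. by rewrite -scaleN1r evZl rmorphN1 mulN1r. Qed.

Lemma evBl (R : realFieldType) (n : nat) (f g : 'rV[rat]_n) (x : 'rV[R]_n) :
  ev (f - g) x = ev f x - ev g x.
Proof. by rewrite evDl evNl. Qed.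

Lemma ev_delta (R : realFieldType) (n : nat) (i : 'I_n) (x : 'rV[R]_n) :
  ev (delta_mx 0 i) x = x 0 i.
Proof.
rewrite /ev (bigD1 i)//= mxE !eqxx rmorph1 mul1r big1 ?addr0// => j ji.
by rewrite mxE (negbTE ji) andbF rmorph0 mul0r.
Qed.

Definition subspace (R : realFieldType) (n : nat) (K : 'rV[R]_n -> Prop) : Prop :=
  forall a b x y, K x -> K y -> K (a *: x + b *: y).

Definition off_walls (R : realFieldType) (n : nat) (Fs : seq 'rV[rat]_n)
  (x : 'rV[R]_n) : bool := all (fun f => ev f x != 0) Fs.

(** One bit per wall suffices: regions are counted off the walls, where not positive means
    negative. *)
Definition signs (R : realFieldType) (n : nat) (Fs : seq 'rV[rat]_n)
  (x : 'rV[R]_n) : (size Fs).-tuple bool :=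
  map_tuple (fun f => 0 < ev f x) (in_tuple Fs).

Lemma signsP (R : realFieldType) (n : nat) (Fs : seq 'rV[rat]_n)
    (x y : 'rV[R]_n) :
  signs Fs x = signs Fs y <-> {in Fs, forall f, (0 < ev f x) = (0 < ev f y)}.
Proof.
split; first by move/(congr1 val) => /= /eq_in_map.
by move=> h; apply: val_inj; apply/eq_in_map.
Qed.

(* The number of regions cut out in the subspace [K] by the hyperplanes
   [ev f x = 0], [f] in [Fs], counted as realised sign vectors. *)
Definition nregions (R : realFieldType) (n : nat) (Fs : seq 'rV[rat]_n)
  (K : 'rV[R]_n -> Prop) : nat :=
  nclass (fun x => K x /\ off_walls Fs x) (signs Fs).

Lemma eq_nregions (R : realFieldType) (n : nat) (Fs : seq 'rV[rat]_n)
    (K L : 'rV[R]_n -> Prop) :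
  (forall x, K x <-> L x) -> nregions Fs K = nregions Fs L.
Proof. by move=> KL; apply: nclass_eq => // x; rewrite KL. Qed.

(** Proportional forms have the same wall, and the sign of one determines that of the other;
    repetitions create no new sign vector. Proportionality on [K] alone is asked, because that is
    how distinct walls merge after restriction. *)
Lemma nregions_proportional (R : realFieldType) (n : nat) (Fs Gs : seq 'rV[rat]_n)
    (K : 'rV[R]_n -> Prop) :
  {in Fs, forall f, exists2 g, g \in Gs & exists2 c, c != 0 &
    forall x, K x -> ev f x = c * ev g x} ->
  {in Gs, forall f, exists2 g, g \in Fs & exists2 c, c != 0 &
    forall x, K x -> ev f x = c * ev g x} ->
  nregions Fs K = nregions Gs K.
Proof.
move=> FG GF.
have off (As Bs : seq 'rV[rat]_n) x : {in As, forall f, exists2 g, g \in Bs &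
    exists2 c, c != 0 & forall x, K x -> ev f x = c * ev g x} ->
    K x -> off_walls Bs x -> off_walls As x.
  move=> h Kx /allP oB; apply/allP => f /h[g gB [c c0 ->//]].
  by rewrite mulf_neq0// oB.
have sg (As Bs : seq 'rV[rat]_n) x y : {in As, forall f, exists2 g, g \in Bs &
    exists2 c, c != 0 & forall x, K x -> ev f x = c * ev g x} ->
    K x -> K y -> off_walls Bs x -> off_walls Bs y ->
    signs Bs x = signs Bs y -> signs As x = signs As y.
  move=> h Kx Ky /allP ox /allP oy /signsP s; apply/signsP => f /h[g gB [c c0 e]].
  rewrite !e//; have := s _ gB; have := ox _ gB; have := oy _ gB.
  move: c0; rewrite !neq_lt => /orP[]c0.
    rewrite !(nmulr_rgt0 _ c0) => /orP[]gy /orP[]gx; rewrite ?gx ?gy//;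
    by rewrite ?(lt_gtF gx) ?(lt_gtF gy).
  by rewrite !(pmulr_rgt0 _ c0).
apply: nclass_eq => [x|x y [Kx ox] [Ky oy]].
  by split=> -[Kx o]; split=> //; apply: off Kx o.
by split; apply: sg => //; apply: off; eassumption.
Qed.

(* Deletion-restriction: [K] is convex, so a region of [Fs] is cut in two by
   the wall of [f] exactly when it meets that wall. *)
Lemma nregions_cons (R : realFieldType) (n : nat) (f : 'rV[rat]_n)
    (Fs : seq 'rV[rat]_n) (K : 'rV[R]_n -> Prop) :
  subspace K -> (exists2 v, K v & ev f v != 0) ->
  nregions (f :: Fs) K =
    (nregions Fs K + nregions Fs (fun x => K x /\ ev f x = 0%R))%N.
Proof.
move=> sK [v Kv fv0].
have -> : nregions (f :: Fs) K = nclass (fun x => K x /\ off_walls (f :: Fs) x)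
    (fun x => (0 < ev f x, signs Fs x)).
  apply: nclass_eq => // x y _ _; rewrite signsP; split.
    move=> h; rewrite h ?mem_head//; congr (_, _); apply/signsP => g gF.
    by apply: h; rewrite in_cons gF orbT.
  move=> h; have /= e := congr1 fst h; have /signsP {}h := congr1 snd h.
  by move=> g; rewrite in_cons => /predU1P[->//|/h].
(* A point on the wall of [f] is moved off it, to a prescribed value of [f]. Scaling [x] up, rather
   than [v] down, preserves the signs on [Fs] and gives [f] exactly the value [c * ev f v]. *)
have push x c : K x -> off_walls Fs x -> ev f x = 0 -> exists2 y, K y &
    [/\ off_walls Fs y, signs Fs y = signs Fs x & ev f y = c * ev f v].
  move=> Kx ox fx0.
  have [N N0 hN] := large_multiple (fun i : 'I_(size Fs) => `|ev Fs`_i x|)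
    (fun i => - `|ev Fs`_i (c *: v)|).
  have small g : g \in Fs -> `|ev g (c *: v)| < `|N * ev g x|.
    move=> gF; have gs : (index g Fs < size Fs)%N by rewrite index_mem.
    have := hN (Ordinal gs); rewrite /= nth_index// normr_gt0 (allP ox g gF).
    by move=> /(_ isT); rewrite subr_gt0 normrM (gtr0_norm N0).
  have same g : g \in Fs -> ev g (N *: x + c *: v) != 0 /\
      (0 < ev g (N *: x + c *: v)) = (0 < ev g x).
    move=> gF; have := small g gF; rewrite evDr [ev g (N *: x)]evZr => sm.
    have gx0 := allP ox g gF.
    rewrite -(pmulr_rgt0 (ev g x) N0).
    move: sm; set a := N * ev g x; set b := ev g (c *: v).
    have : a != 0 by rewrite mulf_neq0 // gt_eqF.
    rewrite neq_lt => /orP[]a0.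
      rewrite (ltr0_norm a0) ltr_norml opprK => /andP[h1 h2].
      have ab : a + b < 0 by lra.
      by rewrite (lt_eqF ab) (lt_gtF ab) (lt_gtF a0).
    rewrite (gtr0_norm a0) ltr_norml => /andP[h1 h2].
    have ab : 0 < a + b by lra.
    by rewrite (gt_eqF ab) ab a0.
  exists (N *: x + c *: v); first exact: sK.
  split.
  - by apply/allP => g /same[].
  - by apply/signsP => g /same[].
  - by rewrite evDr !evZr fx0 mulr0 add0r.
rewrite nclass_bool_pair; congr (_ + _)%N.
  rewrite /nregions /nclass; apply: eq_card => s; rewrite !inE; apply/asboolP/asboolP.
    by move=> [x [Kx /= /andP[_ ox]] <-]; exists x.
  move=> [x [Kx ox] <-]; have [fx0|fx0] := eqVneq (ev f x) 0.
    have [y Ky [oy <- fy]] := push x 1 Kx ox fx0; exists y => //; split=> //=.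
    by rewrite fy mul1r fv0.
  by exists x => //; split=> //=; rewrite fx0.
rewrite /nregions /nclass; apply: eq_card => s; rewrite !inE; apply/asboolP/asboolP.
  move=> [x [[y [Ky /= /andP[fy oy]] [fy0 sy]] [z [Kz /= /andP[fz oz]] [fz0 sz]]] <-].
  have {}fz0 : ev f z < 0 by rewrite lt_neqAle fz leNgt.
  (* [w] is, up to scaling, the point where the segment from [y] to [z] crosses the wall of [f]. *)
  have key g : g \in Fs -> let w := ev f y *: z + (- ev f z) *: y in
      ev g w != 0 /\ (0 < ev g w) = (0 < ev g x).
    move=> gF w; rewrite /w evDr !evZr.
    have hy : (0 < ev g y) = (0 < ev g x) by move/signsP: sy => /(_ g gF).
    have hz : (0 < ev g z) = (0 < ev g x) by move/signsP: sz => /(_ g gF).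
    have := allP oy g gF; have := allP oz g gF; rewrite !neq_lt hy hz.
    case: (0 < ev g x) hy hz => [hy hz _ _|hy hz]; last first.
      rewrite !orbF => gz gy.
      have : ev f y * ev g z + - ev f z * ev g y < 0.
        by rewrite -oppr_gt0 opprD addr_gt0 ?oppr_gt0 ?pmulr_rlt0 ?oppr_gt0.
      by move=> h; rewrite h (lt_gtF h).
    have : 0 < ev f y * ev g z + - ev f z * ev g y.
      by rewrite addr_gt0 ?mulr_gt0 ?oppr_gt0.
    by move=> h; rewrite h orbT.
  exists (ev f y *: z + (- ev f z) *: y).
    split; first split; first exact: sK.
      by rewrite evDr !evZr mulNr mulrC subrr.
    by apply/allP => g /key[].
  by apply/signsP => g /key[].
move=> [x [[Kx fx0] ox] <-].
have [y Ky [oy sy fy]] := push x (ev f v)^-1 Kx ox fx0.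
have [z Kz [oz sz fz]] := push x (- (ev f v)^-1) Kx ox fx0.
move: fy fz; rewrite mulNr mulVf// => fy fz.
exists y; last by rewrite sy.
split; first by exists y; [split=> //=; rewrite fy oner_eq0 | rewrite fy ltr01].
exists z; last by rewrite fz -leNgt oppr_le0 ler01 sz sy.
by split=> //=; rewrite fz oppr_eq0 oner_eq0.
Qed.

(** * Linear relations in general position *)

(* No rational linear relation between the rows of [A] beyond the forced ones:
   [r <= d] rationally independent combinations of the rows are independent. *)
Definition rationally_generic (R : realFieldType) (n d : nat) (A : 'M[R]_(n, d)) :=
  forall (r : nat) (C : 'M[rat]_(r, n)), row_free C -> (r <= d)%N ->
    row_free (map_mx ratr C *m A).

(** The rows of [W] are the rational forms already required to vanish; as [W] is square,
    [(W + f)%MS] has the same type. *)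
Definition relations (R : realFieldType) (n d : nat) (A : 'M[R]_(n, d))
  (W : 'M[rat]_n) (x : 'rV[R]_n) : Prop :=
  x *m A = 0 /\ x *m (map_mx ratr W)^T = 0.

Lemma evE (R : realFieldType) (n : nat) (f : 'rV[rat]_n) (x : 'rV[R]_n) :
  x *m (map_mx ratr f)^T = (ev f x)%:M.
Proof.
apply/matrixP => i j; rewrite !ord1 !mxE eqxx mulr1n.
by apply: eq_bigr => k _; rewrite !mxE mulrC.
Qed.

Lemma relations_subspace (R : realFieldType) (n d : nat) (A : 'M[R]_(n, d))
  (W : 'M[rat]_n) : subspace (relations A W).
Proof.
move=> a b x y [xA xW] [yA yW]; split.
  by rewrite mulmxDl -!scalemxAl xA yA !scaler0 addr0.
by rewrite mulmxDl -!scalemxAl xW yW !scaler0 addr0.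
Qed.

Lemma relations_row_mx (R : realFieldType) (n d : nat) (A : 'M[R]_(n, d))
  (W : 'M[rat]_n) (x : 'rV[R]_n) :
  relations A W x <-> x *m row_mx A (map_mx ratr W)^T = 0.
Proof.
rewrite mul_mx_row; split; first by move=> [-> ->]; rewrite row_mx0.
by rewrite -[X in _ = X]row_mx0 => /eq_row_mx.
Qed.

Lemma relations_sum (R : realFieldType) (n d : nat) (A : 'M[R]_(n, d))
  (W : 'M[rat]_n) (f : 'rV[rat]_n) (x : 'rV[R]_n) :
  relations A (W + f)%MS x <-> relations A W x /\ ev f x = 0.
Proof.
have sub m (B : 'M[rat]_(m, n)) (V : 'M[rat]_n) : (B <= V)%MS ->
    x *m (map_mx ratr V)^T = 0 -> x *m (map_mx ratr B)^T = 0.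
  by move=> /submxP[D ->] xV; rewrite map_mxM trmx_mul mulmxA xV mul0mx.
split=> [[xA xWf]|[[xA xW] fx]].
  split; first by split=> //; apply: sub xWf; rewrite addsmxSl.
  have := sub _ f _ (addsmxSr W f) xWf; rewrite evE.
  by move/matrixP/(_ 0 0); rewrite !mxE eqxx mulr1n.
split=> //; have /sub_addsmxP[[D E] /= ->] := submx_refl (W + f)%MS.
rewrite map_mxD !map_mxM linearD /= !trmx_mul mulmxDr !mulmxA xW evE fx.
by rewrite raddf0 !mul0mx addr0.
Qed.

(** The bound from above is subadditivity. For the other one, the annihilator of [W] has a rational
    basis [C], so the solutions correspond to relations between the rows of [C *m A], and genericity
    bounds the rank of that product from below. *)
Lemma rank_generic (R : realFieldType) (n d : nat) (A : 'M[R]_(n, d))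
    (W : 'M[rat]_n) : rationally_generic A ->
  \rank (row_mx A (map_mx ratr W)^T) = minn n (d + \rank W).
Proof.
move=> gA; set M := row_mx _ _; apply/eqP; rewrite eqn_leq; apply/andP; split.
  rewrite leq_min rank_leq_row /= -mxrank_tr tr_row_mx trmxK -addsmxE.
  apply: leq_trans (mxrank_adds_leqif _ _).1 _.
  by rewrite mxrank_map leq_add2r rank_leq_row.
pose C := row_base (kermx W^T).
have sE : \rank (kermx W^T) = (n - \rank W)%N by rewrite mxrank_ker mxrank_tr.
have kerC : (kermx M <= kermx (map_mx ratr C *m A) *m map_mx ratr C)%MS.
  apply/row_subP => i; set x := row i _.
  have /relations_row_mx[xA xW] : x *m M = 0.
    by apply/sub_kermxP; rewrite /x row_sub.
  have : (x <= map_mx ratr C)%MS.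
    have /eqmxP/andP[_ CW] : (map_mx (ratr : rat -> R) C :=: map_mx ratr (kermx W^T))%MS.
      exact/map_eqmx/eq_row_base.
    apply: submx_trans CW; rewrite map_kermx -map_trmx; exact/sub_kermxP.
  move=> /submxP[y xE]; rewrite xE submxMr//; apply/sub_kermxP.
  by rewrite mulmxA -xE.
have rC : (minn (n - \rank W) d <= \rank (map_mx ratr C *m A))%N.
  (* Genericity speaks of at most [d] combinations, so [D] selects the first [t] rows of [C]. *)
  set t := minn _ d; pose D : 'M[rat]_(t, \rank (kermx W^T)) := pid_mx t.
  have ts : (t <= \rank (kermx W^T))%N by rewrite sE geq_minl.
  have fDC : row_free (D *m C).
    by rewrite /row_free mxrankMfree ?row_base_free// rank_pid_mx.
  have := gA _ _ fDC (geq_minr _ _); rewrite /row_free map_mxM -mulmxA => /eqP tE.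
  by rewrite -{1}tE mxrankM_maxr.
have := mxrankS kerC.
rewrite mxrankMfree ?row_free_map ?row_base_free// !mxrank_ker.
move: rC sE; have := rank_leq_row M; have := rank_leq_row W.
rewrite !geq_min; lia.
Qed.

(** If [f] vanished on the whole space, adding it to [W] would not change the kernel, whereas by
    [rank_generic] the dimension drops. *)
Lemma relations_nonzero (R : realFieldType) (n d : nat) (A : 'M[R]_(n, d))
    (W : 'M[rat]_n) (f : 'rV[rat]_n) :
  rationally_generic A -> ~~ (f <= W)%MS -> (d + \rank W < n)%N ->
  exists2 x, relations A W x & ev f x != 0.
Proof.
move=> gA fW rW; apply: contrapT => none.
have fz x : relations A W x -> ev f x = 0.
  by move=> Kx; apply: contrapT => /eqP fx; apply: none; exists x.
have : (kermx (row_mx A (map_mx ratr W)^T) <=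
        kermx (row_mx A (map_mx ratr (W + f)%MS)^T))%MS.
  apply/rV_subP => x /sub_kermxP/relations_row_mx Kx.
  by apply/sub_kermxP/relations_row_mx/relations_sum; split => //; apply: fz.
move=> /mxrankS; rewrite !mxrank_ker !rank_generic//.
have : (W < W + f)%MS by rewrite ltmxE addsmxSl/= addsmx_sub submx_refl.
move=> /rank_ltmx; have := rank_leq_row (W + f)%MS; lia.
Qed.

Lemma relations_trivial (R : realFieldType) (n d : nat) (A : 'M[R]_(n, d))
    (W : 'M[rat]_n) (x : 'rV[R]_n) :
  rationally_generic A -> (n <= d + \rank W)%N -> relations A W x -> x = 0.
Proof.
move=> gA rW /relations_row_mx xM; apply/eqP.
rewrite -(mulmx_free_eq0 x (B := row_mx A (map_mx ratr W)^T)) ?xM//.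
by rewrite /row_free rank_generic//; apply/eqP/minn_idPl.
Qed.

(* Each active constraint [x_i = 0] can be relaxed independently of the
   others, because the relation space is in general position to them. *)
Lemma positive_relation (R : realFieldType) (n d : nat) (A : 'M[R]_(n, d))
    (l : 'rV[R]_n) : rationally_generic A ->
  (forall i, 0 <= l 0 i) -> l != 0 -> l *m A = 0 ->
  exists2 x : 'rV[R]_n, (forall i, 0 < x 0 i) & x *m A = 0.
Proof.
move=> gA l0 ln0 lA.
pose T := [pred i | l 0 i == 0].
have diagP (p : pred 'I_n) (z : 'rV[R]_n) :
    z *m (map_mx ratr (diag_mx (\row_i (p i)%:R) : 'M[rat]_n))^T = 0 <->
    forall i, p i -> z 0 i = 0.
  rewrite map_diag_mx tr_diag_mx mul_mx_diag; split=> [/rowP e i pi|e].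
    by have := e i; rewrite !mxE pi rmorph1 mulr1.
  apply/rowP => i; rewrite !mxE; case pi : (p i); first by rewrite e ?mul0r.
  by rewrite rmorph0 mulr0.
have /choice[v vP] : forall i, exists v : 'rV[R]_n, T i ->
    [/\ v *m A = 0, v 0 i = 1 & forall j, T j -> j != i -> v 0 j = 0].
  move=> i; have [Ti|nTi] := boolP (T i); last by exists 0 => Ti; case/negP: nTi.
  pose W : 'M[rat]_n := diag_mx (\row_j ([&& T j & j != i])%:R).
  have eW : ~~ ((delta_mx 0 i : 'rV[rat]_n) <= W)%MS.
    apply/negP => /submxP[D] /rowP/(_ i); rewrite mul_mx_diag !mxE !eqxx andbF.
    by rewrite mulr0.
  (* The nonzero [l] itself satisfies the constraints [W], so their solution space is not
     trivial. *)
  have rW : (d + \rank W < n)%N.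
    rewrite ltnNge; apply/negP => nd; move: ln0.
    rewrite (@relations_trivial _ _ _ A W l) ?eqxx//; split=> //.
    by apply/diagP => j /andP[/eqP].
  have [x [xA /diagP xW]] := relations_nonzero gA eW rW.
  rewrite ev_delta => xi0; exists ((x 0 i)^-1 *: x) => _; split.
  - by rewrite -scalemxAl xA scaler0.
  - by rewrite mxE mulVf.
  - by move=> j Tj ji; rewrite mxE (xW j) ?mulr0//=; apply/andP.
pose u := \sum_(i | T i) v i.
have uA : u *m A = 0.
  by rewrite mulmx_suml big1// => i /vP[].
have uT j : T j -> u 0 j = 1.
  move=> Tj; rewrite /u summxE (bigD1 j)//= big1 ?addr0; first by have [] := vP j Tj.
  by move=> i /andP[/vP[_ _ vi] ij]; rewrite vi// eq_sym.
have [N N0 NP] := large_multiple (fun i => l 0 i) (fun i => u 0 i).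
exists (N *: l + u); last by rewrite mulmxDl -scalemxAl lA scaler0 uA addr0.
move=> i; rewrite !mxE; have [li0|li0] := eqVneq (l 0 i) 0.
  by rewrite li0 mulr0 add0r uT ?ltr01//=; apply/eqP.
by apply: NP; rewrite lt_neqAle eq_sym li0 l0.
Qed.

(** * Regions of the reflection arrangement of type B *)

(* The number of chambers of type B_p met by a [q]-dimensional subspace in
   general position; it is [2 ^ p * p`!] as soon as [p <= q]. *)
Fixpoint rho (p q : nat) : nat :=
  match p, q with
  | 0%N, _ => 1
  | p'.+1, 0%N => 0
  | p'.+1, q'.+1 => rho p' q'.+1 + (2 * p' + 1) * rho p' q'
  end%N.

(** The index is a natural number so that [walls] can recurse on it; for [i >= n] the form is 0. *)
Definition coordf (n i : nat) : 'rV[rat]_n := \row_j (j == i :> nat)%:R.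

(* The [2 p + 1] forms [x_p], [x_p - x_k], [x_p + x_k], [k < p], in one indexing. *)
Definition new_wall (n p k : nat) : 'rV[rat]_n :=
  if (k < p)%N then coordf n p - coordf n k
  else if (k < 2 * p)%N then coordf n p + coordf n (k - p)
  else coordf n p.

(** The p^2 reflecting hyperplanes of type B_p, layered by their largest index; the layer sizes 1,
    3, 5, ... are the exponents of the group. *)
Fixpoint walls (n p : nat) : seq 'rV[rat]_n :=
  if p is p'.+1 then
    [seq new_wall n p' k | k <- iota 0 (2 * p' + 1)] ++ walls n p'
  else [::].

Lemma walls_coord (n p i : nat) : (i < p)%N -> coordf n i \in walls n p.
Proof.
elim: p => // p IH; rewrite ltnS leq_eqVlt mem_cat => /predU1P[->|/IH->];
  last by rewrite orbT.
apply/orP; left; apply/mapP; exists (2 * p)%N; first by rewrite mem_iota; lia.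
by rewrite /new_wall !ifF//; lia.
Qed.

Lemma walls_sub (n p i j : nat) : (i < j < p)%N ->
  coordf n j - coordf n i \in walls n p.
Proof.
elim: p => [|p IH]; first by rewrite andbF.
rewrite ltnS [(j <= p)%N]leq_eqVlt mem_cat => /andP[ij /predU1P[jp|jp]]; last first.
  by rewrite IH ?orbT// ij.
apply/orP; left; apply/mapP; exists i; first by rewrite mem_iota; lia.
by rewrite /new_wall -jp ij.
Qed.

Lemma walls_add (n p i j : nat) : (i < j < p)%N ->
  coordf n j + coordf n i \in walls n p.
Proof.
elim: p => [|p IH]; first by rewrite andbF.
rewrite ltnS [(j <= p)%N]leq_eqVlt mem_cat => /andP[ij /predU1P[jp|jp]]; last first.
  by rewrite IH ?orbT// ij.
apply/orP; left; apply/mapP; exists (p + i)%N; first by rewrite mem_iota; lia.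
by rewrite /new_wall ifF ?ifT ?jp; [congr (_ + coordf n _)| |]; lia.
Qed.

Lemma walls_inv (n p : nat) (f : 'rV[rat]_n) : f \in walls n p ->
  (exists2 i, (i < p)%N & f = coordf n i) \/
  (exists i j, (i < j < p)%N /\
     (f = coordf n j - coordf n i \/ f = coordf n j + coordf n i)).
Proof.
elim: p => // p IH; rewrite mem_cat => /orP[/mapP[k]|/IH[[i ip ->]|]].
- rewrite mem_iota /new_wall => kp ->; case: ifP => k1.
    by right; exists k, p; split; [lia|left].
  case: ifP => k2; last by left; exists p.
  by right; exists (k - p)%N, p; split; [lia|right].
- by left; exists i => //; lia.
- move=> [i [j [ijp h]]]; right; exists i, j; split=> //; lia.
Qed.

(** Iterated deletion-restriction: on the wall of one new form the remaining new forms merge with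
    walls of [Fs], so every restriction is cut by [Fs] alone. *)
Lemma nregions_cat (R : realFieldType) (n : nat) (I : eqType)
    (phi : I -> 'rV[rat]_n) (ts : seq I) (Fs : seq 'rV[rat]_n)
    (K : 'rV[R]_n -> Prop) :
  subspace K -> uniq ts ->
  {in ts, forall t, exists2 v, K v & ev (phi t) v != 0} ->
  {in ts &, forall t u, t != u -> exists2 h, h \in Fs & exists2 c, c != 0 &
     forall x, K x /\ ev (phi t) x = 0 -> ev (phi u) x = c * ev h x} ->
  nregions (map phi ts ++ Fs) K =
    (nregions Fs K +
     \sum_(t <- ts) nregions Fs (fun x => K x /\ ev (phi t) x = 0%R))%N.
Proof.
move=> sK; elim: ts => [|t ts IH] /=; first by rewrite big_nil addn0.
move=> /andP[tts uts] nz dep; rewrite nregions_cons//; last exact/nz/mem_head.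
rewrite IH//; last 2 first.
- by move=> u uts'; apply: nz; rewrite in_cons uts' orbT.
- by move=> u v uts' vts'; apply: dep; rewrite in_cons ?uts' ?vts' orbT.
rewrite big_cons addnAC -addnA; congr (_ + (_ + _))%N.
apply: nregions_proportional => f; last first.
  by move=> fF; exists f; [rewrite mem_cat fF orbT|exists 1; rewrite ?oner_eq0// => x; rewrite mul1r].
rewrite mem_cat => /orP[/mapP[u uts' ->]|fF]; last first.
  by exists f => //; exists 1; rewrite ?oner_eq0// => x; rewrite mul1r.
apply: dep; rewrite ?mem_head ?in_cons ?uts' ?orbT//.
by apply: contraNneq tts => ->.
Qed.

(** Solving the first form for x_p and substituting in the second leaves a multiple of a root in the
    first [p] coordinates. *)
Lemma walls_dependent (R : realFieldType) (n p k l : nat) :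
  (k < 2 * p + 1)%N -> (l < 2 * p + 1)%N -> k != l ->
  exists2 h, h \in walls n p & exists2 c : R, c != 0 & forall x : 'rV[R]_n,
    ev (new_wall n p k) x = 0 -> ev (new_wall n p l) x = c * ev h x.
Proof.
have n1 : (-1 : R) != 0 by rewrite oppr_eq0 oner_eq0.
have n2 : (2 : R) != 0 by rewrite pnatr_eq0.
have n3 : (-2 : R) != 0 by rewrite oppr_eq0 pnatr_eq0.
have one i (c : R) : (i < p)%N -> c != 0 -> exists2 h, h \in walls n p &
    exists2 c : R, c != 0 & forall x, c * ev (coordf n i) x = c * ev h x.
  by move=> ip c0; exists (coordf n i); rewrite ?walls_coord//; exists c.
have dif i j : (i < p)%N -> (j < p)%N -> i != j -> exists2 h, h \in walls n p &
    exists2 c : R, c != 0 & forall x, ev (coordf n i) x - ev (coordf n j) x = c * ev h x.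
  move=> ip jp; case: ltngtP => // ij _.
    exists (coordf n j - coordf n i); first by rewrite walls_sub// ij.
    by exists (-1) => // x; rewrite evBl; ring.
  exists (coordf n i - coordf n j); first by rewrite walls_sub// ij.
  by exists 1; rewrite ?oner_eq0// => x; rewrite evBl; ring.
have sum i j : (i < p)%N -> (j < p)%N -> exists2 h, h \in walls n p &
    exists2 c : R, c != 0 & forall x, ev (coordf n i) x + ev (coordf n j) x = c * ev h x.
  move=> ip jp; case: (ltngtP i j) => ij.
  - exists (coordf n j + coordf n i); first by rewrite walls_add// ij.
    by exists 1; rewrite ?oner_eq0// => x; rewrite evDl; ring.
  - exists (coordf n i + coordf n j); first by rewrite walls_add// ij.
    by exists 1; rewrite ?oner_eq0// => x; rewrite evDl; ring.
  (* The walls x_p = x_i and x_p = -x_i meet where 2 x_i = 0: this is where the coordinate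
     hyperplanes enter. *)
  - exists (coordf n i); first by rewrite walls_coord.
    by exists 2 => // x; rewrite ij; ring.
have neg i j : (i < p)%N -> (j < p)%N -> exists2 h, h \in walls n p &
    exists2 c : R, c != 0 & forall x, - ev (coordf n i) x - ev (coordf n j) x = c * ev h x.
  move=> ip jp; have [h hw [c c0 e]] := sum i j ip jp.
  exists h => //; exists (- c); first by rewrite oppr_eq0.
  by move=> x; rewrite mulNr -e opprD.
move=> kp lp kl; rewrite /new_wall.
have [k1|k1] := ltnP k p; have [l1|l1] := ltnP l p.
- have [h hw [c c0 e]] := dif k l k1 l1 kl; exists h => //; exists c => // x.
  by rewrite !evBl -e => /eqP; rewrite subr_eq0 => /eqP ->.
- have [l2|l2] := ltnP l (2 * p)%N.
    have [|h hw [c c0 e]] := sum k (l - p)%N k1; first lia.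
    exists h => //; exists c => // x.
    by rewrite evBl evDl -e => /eqP; rewrite subr_eq0 => /eqP ->.
  exists (coordf n k); [exact: walls_coord|exists 1; rewrite ?oner_eq0// => x].
  by rewrite evBl mul1r => /eqP; rewrite subr_eq0 => /eqP ->.
- have [k2|k2] := ltnP k (2 * p)%N.
    have [||h hw [c c0 e]] := neg (k - p)%N l; [lia|lia|].
    exists h => //; exists c => // x.
    by rewrite evBl evDl -e => /eqP; rewrite addr_eq0 => /eqP ->.
  exists (coordf n l); [exact: walls_coord|exists (-1) => // x].
  by rewrite evBl => ->; rewrite sub0r mulN1r.
- have [k2|k2] := ltnP k (2 * p)%N; have [l2|l2] := ltnP l (2 * p)%N.
  + have [|||h hw [c c0 e]] := dif (l - p)%N (k - p)%N; [lia|lia| |].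
      by apply: contra_neq kl; lia.
    exists h => //; exists c => // x.
    by rewrite !evDl -e => /eqP; rewrite addr_eq0 => /eqP ->; rewrite addrC.
  + exists (coordf n (k - p)); [by apply: walls_coord; lia|exists (-1) => // x].
    by rewrite evDl mulN1r => /eqP; rewrite addr_eq0 => /eqP.
  + exists (coordf n (l - p)); [by apply: walls_coord; lia|exists 1; rewrite ?oner_eq0// => x].
    by rewrite evDl mul1r => ->; rewrite add0r.
  + by move: kl; rewrite (_ : k = l) ?eqxx//; lia.
Qed.

(* Supersolvability of the reflection arrangement of type B: on the wall of
   one new form all other new forms become proportional to old ones. *)
Lemma nregions_walls (R : realFieldType) (n d : nat) (A : 'M[R]_(n, d)) :
  rationally_generic A -> forall (p : nat) (W : 'M[rat]_n), (p <= n)%N ->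
  (forall v : 'rV[rat]_n, (v <= W)%MS ->
     (forall j : 'I_n, (p <= j)%N -> v 0 j = 0) -> v = 0) ->
  nregions (walls n p) (relations A W) = rho p (n - (d + \rank W)).
Proof.
(* [indep] says that the row space of [W] contains no nonzero form in the first [p] coordinates; it
   keeps the new walls out of [W]. *)
move=> gA; elim=> [|p IH] W pn indep.
  rewrite /nregions /nclass (eq_card (B := predT)) ?card_tuple ?expn0// => s.
  rewrite !inE tuple0; apply/asboolP; exists 0; last by rewrite tuple0.
  by split=> //; split; rewrite mul0mx.
(* Here the space is 0 and lies on the coordinate wall of [p]: no region, in accordance with
   [rho p.+1 0 = 0]. *)
have [nd|nd] := leqP n (d + \rank W).
  rewrite (eqP (_ : n - (d + \rank W) == 0)%N) ?subn_eq0//= /nregions /nclass.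
  apply: eq_card0 => s; rewrite !inE; apply/asboolP => -[x [Kx /allP ox] _].
  have := ox (coordf n p) (walls_coord n (ltnSn p)).
  rewrite (relations_trivial gA nd Kx) /ev big1 ?eqxx// => i _.
  by rewrite [X in _ * X]mxE mulr0.
have hD (f g : 'rV[rat]_n) j : (f + g) 0 j = f 0 j + g 0 j by rewrite mxE.
have hB (f g : 'rV[rat]_n) j : (f - g) 0 j = f 0 j - g 0 j by rewrite !mxE.
have wj k (j : 'I_n) : (p < j)%N -> (k < 2 * p + 1)%N -> new_wall n p k 0 j = 0.
  move=> pj kp; have z i : (i <= p)%N -> coordf n i 0 j = 0.
    by move=> ip; rewrite mxE gtn_eqF// (leq_ltn_trans ip).
  rewrite /new_wall; case: ifP => k1; [|case: ifP => k2]; rewrite ?hB ?hD !z ?subr0 ?addr0//; lia.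
have wp k : (k < 2 * p + 1)%N -> new_wall n p k 0 (Ordinal pn) = 1.
  move=> kp; have z i : (i < p)%N -> coordf n i 0 (Ordinal pn) = 0.
    by move=> ip; rewrite mxE gtn_eqF.
  have o : coordf n p 0 (Ordinal pn) = 1 by rewrite mxE eqxx.
  rewrite /new_wall; case: ifP => k1; last case: ifP => k2 //.
    by rewrite hB o z// subr0.
  by rewrite hD o z ?addr0//; lia.
have wW k : (k < 2 * p + 1)%N -> ~~ (new_wall n p k <= W)%MS.
  move=> kp; apply/negP => /indep h; have := wp k kp.
  rewrite h; first by rewrite mxE => /eqP; rewrite eq_sym oner_eq0.
  by move=> j pj; apply: wj.
rewrite /= nregions_cat ?iota_uniq//; last 3 first.
- exact: relations_subspace.
- by move=> k; rewrite mem_iota => kp; apply: relations_nonzero => //; apply: wW; lia.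
- move=> k l; rewrite !mem_iota => kp lp kl.
  have [//|//|h hw [c c0 e]] := @walls_dependent R n p k l _ _ kl.
  by exists h => //; exists c => // x [_]; apply: e.
rewrite IH ?(ltnW pn)//; last first.
  by move=> v vW vp; apply: indep => // j pj; apply: vp; apply: ltnW.
have -> : (n - (d + \rank W) = (n - (d + \rank W)).-1.+1)%N.
  by rewrite prednK// subn_gt0.
congr (_ + _)%N; rewrite big_seq (eq_bigr (fun=> rho p (n - (d + \rank W)).-1)).
  by rewrite -big_seq big_const_seq count_predT size_iota iter_addn_0 mulnC.
move=> k; rewrite mem_iota add0n /= => kp.
rewrite (@eq_nregions _ _ _ _ (relations A (W + new_wall n p k)%MS)); last first.
  by move=> x; rewrite relations_sum.
have rW : \rank (W + new_wall n p k)%MS = (\rank W).+1.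
  apply/eqP; rewrite eqn_leq; apply/andP; split.
    apply: leq_trans (mxrank_adds_leqif _ _).1 _.
    by rewrite -[(\rank W).+1]addn1 leq_add2l rank_leq_row.
  by apply: rank_ltmx; rewrite ltmxE addsmxSl/= addsmx_sub submx_refl wW.
rewrite IH ?(ltnW pn)//; first by congr rho; rewrite rW; lia.
(* Beyond [p] the new wall has zero entries, so the component in [W] vanishes by [indep]; entry [p]
   then kills the multiple of the new wall. *)
move=> v /sub_addsmxP[[D E] /= ->] vp.
have D0 : D *m W = 0.
  apply: indep; first exact: submxMl.
  move=> j pj; have := vp j (ltnW pj); rewrite mxE => /eqP.
  by rewrite addr_eq0 [(E *m _) _ _]mxE big_ord1 wj// mulr0 oppr0 => /eqP.
have := vp (Ordinal pn) (leqnn p).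
rewrite D0 add0r mxE big_ord1 wp// mulr1 => E0.
by apply/rowP => j; rewrite mxE big_ord1 E0 mul0r mxE.
Qed.

(** * Weyl chambers and signed permutations *)

Lemma ev_coordf (R : realFieldType) (n : nat) (i : 'I_n) (x : 'rV[R]_n) :
  ev (coordf n i) x = x 0 i.
Proof.
rewrite -ev_delta; congr ev; apply/rowP => j; rewrite !mxE eqxx /=.
by rewrite -val_eqE.
Qed.

Definition signed_perm (n : nat) : finType := ('S_n * {ffun 'I_n -> bool})%type.

Definition signed_coord (F : pzRingType) (n : nat) (g : signed_perm n)
  (x : 'rV[F]_n) (i : 'I_n) : F := (-1) ^+ g.2 i * x 0 (g.1 i).

(** The signed coordinates decrease because they arise as tail sums of the weights of the partial
    sums. *)
Definition chamber (R : realFieldType) (n : nat) (g : signed_perm n)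
  (x : 'rV[R]_n) : Prop :=
  (forall i j : 'I_n, (i < j)%N -> signed_coord g x j < signed_coord g x i) /\
  (forall i, 0 < signed_coord g x i).

Lemma signed_coordK (F : pzRingType) (n : nat) (g : signed_perm n)
  (x : 'rV[F]_n) (i : 'I_n) : x 0 (g.1 i) = (-1) ^+ g.2 i * signed_coord g x i.
Proof. by rewrite /signed_coord mulrA -expr2 sqrr_sign mul1r. Qed.

Lemma off_wallsP (R : realFieldType) (n : nat) (x : 'rV[R]_n) :
  off_walls (walls n n) x <->
  (forall i, x 0 i != 0) /\
  (forall i j, i != j -> x 0 j - x 0 i != 0 /\ x 0 j + x 0 i != 0).
Proof.
split=> [/allP ox|[x0 xs]].
  split=> [i|i j ij]; first by rewrite -ev_coordf; apply/ox/walls_coord.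
  wlog lij : i j ij / (i < j)%N => [h|].
    case: (ltngtP i j) => [/(h _ _ ij)//|ji|/val_inj e]; last by rewrite e eqxx in ij.
    have [h1 h2] := h j i (contra_neq (@esym _ _ _) ij) ji.
    by split; [rewrite -opprB oppr_eq0|rewrite addrC].
  split; rewrite -!ev_coordf -?evBl -?evDl; apply: ox.
    by apply: walls_sub; rewrite lij ltn_ord.
  by apply: walls_add; rewrite lij ltn_ord.
apply/allP => f /walls_inv[[i ip ->]|[i [j [/andP[ij jp] h]]]].
  by rewrite (ev_coordf (Ordinal ip)).
have [|h1 h2] := xs (Ordinal (ltn_trans ij jp)) (Ordinal jp).
  by rewrite -val_eqE /= ltn_eqF.
case: h => ->; rewrite ?evBl ?evDl (ev_coordf (Ordinal jp));
by rewrite (ev_coordf (Ordinal (ltn_trans ij jp))).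
Qed.

Lemma walls_signsP (R : realFieldType) (n : nat) (x y : 'rV[R]_n) :
  signs (walls n n) x = signs (walls n n) y <->
  (forall i, (0 < x 0 i) = (0 < y 0 i)) /\
  (forall i j : 'I_n, (i < j)%N -> (0 < x 0 j - x 0 i) = (0 < y 0 j - y 0 i) /\
     (0 < x 0 j + x 0 i) = (0 < y 0 j + y 0 i)).
Proof.
split=> [/signsP s|[s0 s]].
  split=> [i|i j ij]; first by have := s _ (walls_coord n (ltn_ord i)); rewrite !ev_coordf.
  have ijn : (i < j < n)%N by rewrite ij ltn_ord.
  have := s _ (walls_sub n ijn); have := s _ (walls_add n ijn).
  by rewrite !evDl !evNl !ev_coordf.
apply/signsP => f /walls_inv[[i ip ->]|[i [j [/andP[ij jp] h]]]].
  by rewrite !(ev_coordf (Ordinal ip)).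
have [//|h1 h2] := s (Ordinal (ltn_trans ij jp)) (Ordinal jp).
case: h => ->; rewrite ?evBl ?evDl !(ev_coordf (Ordinal jp));
by rewrite !(ev_coordf (Ordinal (ltn_trans ij jp))).
Qed.

Lemma chamber_off_walls (R : realFieldType) (n : nat) (g : signed_perm n)
  (x : 'rV[R]_n) : chamber g x -> off_walls (walls n n) x.
Proof.
move=> [dec pos]; apply/off_wallsP; split=> [a|a b].
  rewrite -(permKV g.1 a) signed_coordK mulf_neq0// ?signr_eq0//.
  by rewrite gt_eqF.
rewrite -(permKV g.1 a) -(permKV g.1 b) !signed_coordK.
set i := (g.1^-1)%g a; set j := (g.1^-1)%g b; rewrite (inj_eq perm_inj) => ij.
have := pos i; have := pos j; have := dec i j; have := dec j i.
rewrite neq_ltn in ij; move: ij.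
set u := signed_coord g x i; set v := signed_coord g x j.
move=> ij h1 h2 v0 u0.
have uv : u != v by case/orP: ij => [/h2|/h1] h; rewrite ?(gt_eqF h) ?(lt_eqF h).
have uv' : u + v != 0 by rewrite gt_eqF// addr_gt0.
case: (g.2 i); case: (g.2 j); rewrite ?expr1 ?expr0 ?mulN1r ?mul1r ?opprK.
- by rewrite addrC subr_eq0 -opprD oppr_eq0 addrC.
- by rewrite addrC uv' subr_eq0 eq_sym.
- by rewrite -opprD oppr_eq0 addrC uv' addrC subr_eq0.
- by rewrite subr_eq0 eq_sym addrC.
Qed.

(** In a chamber the sign of a sum or difference of two entries is decided by the one of larger
    absolute value, which [g] determines. *)
Lemma chamber_signs (R : realFieldType) (n : nat) (g : signed_perm n)
  (x y : 'rV[R]_n) : chamber g x -> chamber g y ->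
  signs (walls n n) x = signs (walls n n) y.
Proof.
move=> [decx posx] [decy posy]; apply/walls_signsP; split=> [a|a b ab].
  rewrite -(permKV g.1 a) !signed_coordK.
  have := posx ((g.1^-1)%g a); have := posy ((g.1^-1)%g a).
  case: (g.2 _) => hy hx; last by rewrite !expr0 !mul1r hx hy.
  by rewrite !expr1 !mulN1r !oppr_gt0 (lt_gtF hx) (lt_gtF hy).
have : a != b by rewrite -val_eqE ltn_eqF.
rewrite -(permKV g.1 a) -(permKV g.1 b) !signed_coordK.
set i := (g.1^-1)%g a; set j := (g.1^-1)%g b; rewrite (inj_eq perm_inj) neq_ltn => ij.
have := posx i; have := posx j; have := decx i j; have := decx j i.
have := posy i; have := posy j; have := decy i j; have := decy j i.
move: ij.
set u := signed_coord g x i; set v := signed_coord g x j.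
set u' := signed_coord g y i; set v' := signed_coord g y j.
move=> ij h1 h2 v0 u0 h3 h4 v'0 u'0.
case/orP: ij => ij;
  [move: (h2 ij) (h4 ij) => k1 k2|move: (h1 ij) (h3 ij) => k1 k2];
case: (g.2 i); case: (g.2 j); rewrite ?expr1 ?expr0 ?mulN1r ?mul1r ?opprK;
by split; apply/idP/idP => h; lra.
Qed.

(** Each inequality defining the chamber is, up to sign, positivity of one of the wall forms. *)
Lemma signs_chamber (R : realFieldType) (n : nat) (g : signed_perm n)
  (x y : 'rV[R]_n) : off_walls (walls n n) x -> off_walls (walls n n) y ->
  signs (walls n n) x = signs (walls n n) y -> chamber g x -> chamber g y.
Proof.
move=> /off_wallsP[x0 xs] /off_wallsP[y0 ys] /walls_signsP[s0 s] [dec pos]; split.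
  move=> i j ij; have := dec i j ij; rewrite /signed_coord.
  set a := g.1 i; set b := g.1 j.
  have ab : a != b by rewrite (inj_eq perm_inj) -val_eqE ltn_eqF.
  have [ys1 ys2] := ys a b ab.
  have {}[s1 s2] : (0 < x 0 b - x 0 a) = (0 < y 0 b - y 0 a) /\
     (0 < x 0 b + x 0 a) = (0 < y 0 b + y 0 a).
    have := ab; rewrite neq_ltn => /orP[/s//|/s[p1 p2]].
    split; last by rewrite [x 0 b + _]addrC [y 0 b + _]addrC.
    have [xs1 _] := xs a b ab; move: xs1 ys1 p1; rewrite !subr_eq0 !subr_gt0.
    by case: ltgtP => // _ _; case: ltgtP.
  move: ys1 ys2 s1 s2; case: (g.2 i); case: (g.2 j);
  rewrite ?expr1 ?expr0 ?mulN1r ?mul1r => ys1 ys2 s1 s2 h.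
  - have : 0 < y 0 b - y 0 a by rewrite -s1; lra.
    by lra.
  - have : ~~ (0 < y 0 b + y 0 a) by rewrite -s2 -leNgt; lra.
    by rewrite -leNgt le_eqVlt (negbTE ys2)/= => ?; lra.
  - have : 0 < y 0 b + y 0 a by rewrite -s2; lra.
    by lra.
  - have : ~~ (0 < y 0 b - y 0 a) by rewrite -s1 -leNgt; lra.
    by rewrite -leNgt le_eqVlt (negbTE ys1)/= => ?; lra.
move=> i; have := pos i; rewrite /signed_coord.
have := s0 (g.1 i); have := y0 (g.1 i).
case: (g.2 i) => yi sx xi; last by move: xi; rewrite !expr0 !mul1r sx.
move: xi sx; rewrite !expr1 !mulN1r !oppr_gt0 => xi.
by rewrite (lt_gtF xi) => /esym/negbT; rewrite -leNgt le_eqVlt (negbTE yi).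
Qed.

(** [g] sorts the entries by decreasing absolute value and records their signs; off the walls there
    are no ties. *)
Lemma chamber_exists (R : realFieldType) (n : nat) (x : 'rV[R]_n) :
  off_walls (walls n n) x -> exists g, chamber g x.
Proof.
move=> /off_wallsP[x0 xs].
have ax i j : i != j -> `|x 0 i| != `|x 0 j|.
  move=> /xs[h1 h2]; rewrite eqr_norm2 negb_or -[_ == - _]addr_eq0 addrC h2 andbT.
  by rewrite eq_sym -subr_eq0.
pose le : rel 'I_n := fun i j => `|x 0 j| <= `|x 0 i|.
have /tuple_permP[p pE] : perm_eq (sort le (enum 'I_n)) (ord_tuple n).
  by rewrite perm_sort val_ord_tuple.
have tr : transitive le by move=> a b c h1 h2; apply: le_trans h2 h1.
have rf : reflexive le by move=> a; apply: lexx.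
have so : sorted le (sort le (enum 'I_n)).
  by apply: sort_sorted => a b; apply: le_total.
exists (p, [ffun i => x 0 (p i) < 0]).
have sE i : signed_coord (p, [ffun i => x 0 (p i) < 0]) x i = `|x 0 (p i)|.
  rewrite /signed_coord/= ffunE; have := x0 (p i).
  rewrite neq_lt => /orP[h|h]; first by rewrite h expr1 mulN1r ltr0_norm.
  by rewrite (lt_gtF h) expr0 mul1r gtr0_norm.
split=> [i j ij|i]; rewrite !sE ?normr_gt0//.
rewrite lt_neqAle ax ?(inj_eq perm_inj) -?val_eqE ?gtn_eqF//=.
have := sorted_leq_nth tr rf i so i j.
have nE (k : 'I_n) : nth i (sort le (enum 'I_n)) k = p k.
  by rewrite pE (nth_map k) ?size_enum_ord// nth_ord_enum tnth_ord_tuple.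
by rewrite !nE /le; apply; rewrite ?inE ?size_sort ?size_enum_ord// ltnW.
Qed.

(** A strictly sorted sequence is determined by its set of values; this fixes the permutation, and
    positivity fixes the signs. *)
Lemma chamber_unique (R : realFieldType) (n : nat) (g h : signed_perm n)
  (x : 'rV[R]_n) : chamber g x -> chamber h x -> g = h.
Proof.
have absE (k : signed_perm n) i : chamber k x -> `|x 0 (k.1 i)| = signed_coord k x i.
  move=> [_ pos]; rewrite signed_coordK normrM normr_sign mul1r gtr0_norm//.
move=> cg ch.
have xi i j : i != j -> `|x 0 i| != `|x 0 j|.
  have /off_wallsP[_ xs] := chamber_off_walls cg.
  move=> /xs[h1 h2]; rewrite eqr_norm2 negb_or -[_ == - _]addr_eq0 addrC h2 andbT.
  by rewrite eq_sym -subr_eq0.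
have so (k : signed_perm n) : chamber k x ->
    sorted (fun a b : R => b < a) [seq `|x 0 (k.1 i)| | i <- enum 'I_n].
  move=> ck; rewrite sorted_map.
  apply: (@sub_sorted _ (fun i j : 'I_n => (i < j)%N)).
    by move=> i j ij /=; rewrite !absE//; apply: ck.1.
  by have := iota_ltn_sorted 0 n; rewrite -val_enum_ord sorted_map.
have tr : transitive (fun a b : R => b < a) by move=> a b c h1 h2; apply: lt_trans h2 h1.
have e : [seq `|x 0 (g.1 i)| | i <- enum 'I_n] = [seq `|x 0 (h.1 i)| | i <- enum 'I_n].
  apply: (irr_sorted_eq tr) (so _ cg) (so _ ch) _; first by move=> a; rewrite ltxx.
  have im (k : signed_perm n) : [seq `|x 0 (k.1 i)| | i <- enum 'I_n] =i
      [seq `|x 0 i| | i <- enum 'I_n].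
    move=> a; apply/mapP/mapP => -[i _ ->].
      by exists (k.1 i); rewrite ?mem_enum.
    by exists ((k.1^-1)%g i); rewrite ?mem_enum ?permKV.
  by move=> a; rewrite !im.
have gh1 : g.1 = h.1.
  apply/permP => i; have /eq_in_map/(_ i) := e; rewrite mem_enum => /(_ isT) ei.
  by apply: contra_eq ei; apply: xi.
rewrite [g]surjective_pairing [h]surjective_pairing -gh1; congr (_, _).
apply/ffunP => i; have := cg.2 i; have := ch.2 i; rewrite /signed_coord -gh1.
case: (g.2 i); case: (h.2 i) => //; rewrite ?expr1 ?expr0 ?mulN1r ?mul1r ?oppr_gt0;
by move=> /lt_gtF ->.
Qed.

Lemma card_chambers (R : realFieldType) (n : nat) (K : 'rV[R]_n -> Prop) :
  #|[pred g : signed_perm n | `[< exists2 x, K x & chamber g x >]]| =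
  nregions (walls n n) K.
Proof.
have /choice[gam gamP] : forall x : 'rV[R]_n, exists g : signed_perm n,
    off_walls (walls n n) x -> chamber g x.
  move=> x; have [ox|ox] := boolP (off_walls (walls n n) x).
    by have [g gx] := chamber_exists ox; exists g.
  by exists (1%g, [ffun=> false]).
transitivity (nclass (fun x => K x /\ off_walls (walls n n) x) gam).
  apply: eq_card => g; rewrite !inE; apply/asboolP/asboolP.
    move=> [x Kx gx]; have ox := chamber_off_walls gx; exists x => //.
    exact: chamber_unique (gamP x ox) gx.
  by move=> [x [Kx ox] <-]; exists x => //; apply: gamP.
apply: nclass_eq => // x y [_ ox] [_ oy]; split=> [e|e].
  by apply: (chamber_signs (gamP x ox)); rewrite e; apply: gamP.
apply: (@chamber_unique _ _ _ _ y _ (gamP y oy)).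
exact: signs_chamber ox oy e (gamP x ox).
Qed.

(** * Abel summation and the convex hull of a signed walk *)

Definition partial_sum_mx (F : pzRingType) (n : nat) (g : signed_perm n) : 'M[F]_n :=
  \matrix_(k, j) \sum_(i < n | (i <= k)%N) (-1) ^+ g.2 i * (g.1 i == j)%:R.

Definition signed_walk (F : pzRingType) (n d : nat) (g : signed_perm n)
  (A : 'M[F]_(n, d)) (k : 'I_n) : 'rV[F]_d :=
  \sum_(i < n | (i <= k)%N) (-1) ^+ g.2 i *: row (g.1 i) A.

Lemma signed_walkE (F : pzRingType) (n d : nat) (g : signed_perm n)
  (A : 'M[F]_(n, d)) (k : 'I_n) :
  signed_walk g A k = row k (partial_sum_mx F g *m A).
Proof.
apply/rowP => j; rewrite !mxE summxE.
under [RHS]eq_bigr => m _ do rewrite !mxE mulr_suml.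
rewrite exchange_big /=; apply: eq_bigr => i _; rewrite !mxE.
rewrite (bigD1 (g.1 i))//= eqxx mulr1 big1 ?addr0// => m mi.
by rewrite eq_sym (negbTE mi) mulr0 mul0r.
Qed.

(** Abel summation: the [i]-th step occurs in exactly the partial sums of index [k >= i]. *)
Lemma signed_coord_partial_sum (F : comPzRingType) (n : nat) (g : signed_perm n)
  (l : 'rV[F]_n) (i : 'I_n) :
  signed_coord g (l *m partial_sum_mx F g) i = \sum_(k < n | (i <= k)%N) l 0 k.
Proof.
rewrite /signed_coord mxE [in RHS]big_mkcond mulr_sumr; apply: eq_bigr => k _.
rewrite mxE; case: ifPn => ik.
  rewrite (bigD1 i)//= eqxx mulr1 big1 ?addr0.
    by rewrite mulrCA -expr2 sqrr_sign mulr1.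
  by move=> m /andP[_ mi]; rewrite (inj_eq perm_inj) (negbTE mi) mulr0.
rewrite big1 ?mulr0// => m mk; rewrite (inj_eq perm_inj).
by rewrite (_ : (m == i) = false) ?mulr0//; apply: contraNF ik => /eqP <-.
Qed.

(** The inverse of taking tail sums; the default 0 of [oapp] supplies the term after the last
    one. *)
Definition steps (F : pzRingType) (n : nat) (y : 'I_n -> F) : 'rV[F]_n :=
  let Y (m : nat) := oapp y 0 (insub m) in \row_(k < n) (Y k - Y k.+1).

Lemma sum_steps (F : pzRingType) (n : nat) (y : 'I_n -> F) (i : 'I_n) :
  \sum_(k < n | (i <= k)%N) steps y 0 k = y i.
Proof.
pose Y (m : nat) := oapp y 0 (insub m).
rewrite (eq_bigr (fun k : 'I_n => Y (nat_of_ord k) - Y (nat_of_ord k).+1)); last by move=> k _; rewrite mxE.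
rewrite -(big_geq_mkord i n xpredT (fun k => Y k - Y k.+1)).
rewrite (eq_bigr (fun k => - (Y k.+1 - Y k))); last by move=> k _; rewrite opprB.
rewrite sumrN telescope_sumr ?(ltnW (ltn_ord i))// opprB /Y insubT//= insubF ?ltnn//=.
by move=> p; rewrite subr0; congr y; apply: val_inj.
Qed.

Lemma steps_partial_sum (F : comPzRingType) (n : nat) (g : signed_perm n)
  (x : 'rV[F]_n) : steps (signed_coord g x) *m partial_sum_mx F g = x.
Proof.
apply/rowP => j; rewrite -(permKV g.1 j) !(signed_coordK g).
by rewrite signed_coord_partial_sum sum_steps.
Qed.

Lemma row_free_partial_sum (F : fieldType) (n : nat) (g : signed_perm n) :
  row_free (partial_sum_mx F g).
Proof.
(* For a square matrix [row_full] and [row_free] are convertible, so surjectivity through [steps]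
   suffices. *)
rewrite -(_ : row_full (partial_sum_mx F g) = row_free (partial_sum_mx F g)) //.
rewrite -sub1mx; apply/row_subP => i; apply/submxP.
by exists (steps (signed_coord g (row i 1%:M))); rewrite steps_partial_sum.
Qed.

(** The partial-sum matrix is rational and invertible, so multiplying by it keeps a rational [C] of
    full row rank. *)
Lemma generic_partial_sum (R : realFieldType) (n d : nat) (g : signed_perm n)
  (A : 'M[R]_(n, d)) : rationally_generic A ->
  rationally_generic (partial_sum_mx R g *m A).
Proof.
move=> gA r C fC rd.
have -> : partial_sum_mx R g = map_mx ratr (partial_sum_mx rat g).
  apply/matrixP => i j; rewrite !mxE rmorph_sum; apply: eq_bigr => k _.
  by rewrite rmorphM rmorph_sign rmorph_nat.
rewrite mulmxA -map_mxM; apply: gA => //.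
by rewrite /row_free mxrankMfree ?row_free_partial_sum.
Qed.

(** In terms of the weights of the partial sums the closed chamber is the nonnegative orthant;
    [positive_relation] for the matrix of partial sums moves a solution into its interior. *)
Lemma in_conv_signed_walk (R : realType) (n d : nat) (g : signed_perm n)
    (A : 'M[R]_(n, d)) : (0 < n)%N -> rationally_generic A ->
  in_conv_hull (signed_walk g A) 0 <->
  exists2 x : 'rV[R]_n, x *m A = 0 & chamber g x.
Proof.
move=> n0 gA; have comb (l : 'I_n -> R) : \sum_k l k *: signed_walk g A k =
    (\row_k l k) *m partial_sum_mx R g *m A.
  rewrite -mulmxA mulmx_sum_row; apply: eq_bigr => k _.
  by rewrite signed_walkE mxE.
split=> [[l [l0 [l1 lS]]]|[x xA [dec pos]]].
  have ln0 : \row_k l k != 0.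
    apply: contra_eq_neq l1 => /rowP e; rewrite big1 ?(eq_sym 0) ?oner_eq0//.
    by move=> k _; have := e k; rewrite !mxE.
  have l0' i : 0 <= (\row_k l k) 0 i by rewrite mxE.
  have lA : \row_k l k *m (partial_sum_mx R g *m A) = 0 by rewrite mulmxA -comb.
  have [y y0 yA] := positive_relation (generic_partial_sum g gA) l0' ln0 lA.
  exists (y *m partial_sum_mx R g); first by rewrite -mulmxA.
  split=> [i j ij|i]; rewrite !signed_coord_partial_sum.
    rewrite [ltRHS](bigID (fun k : 'I_n => (j <= k)%N))/=.
    rewrite [X in _ < X + _](eq_bigl (fun k : 'I_n => (j <= k)%N)); last first.
      by move=> k; apply: andb_idl => /(leq_trans (ltnW ij)).
    rewrite ltrDl (bigD1 i)/=; last by rewrite leqnn -ltnNge.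
    by rewrite ltr_wpDr// sumr_ge0// => k _; apply: ltW.
  by rewrite (bigD1 i)//= ltr_wpDr// sumr_ge0// => k _; apply: ltW.
pose l := steps (signed_coord g x).
have l0 k : 0 < l 0 k.
  rewrite mxE insubT//= => kn; rewrite (_ : Sub _ _ = k); last exact: val_inj.
  by case: insubP => [i _ ik|_] /=; rewrite subr_gt0 ?dec ?pos// ik.
have s0 : 0 < \sum_k l 0 k.
  by rewrite (bigD1 (Ordinal n0))//= ltr_wpDr// sumr_ge0// => k _; apply: ltW.
exists (fun k => l 0 k / \sum_k l 0 k); split.
  by move=> k; rewrite divr_ge0// ltW.
split; first by rewrite -mulr_suml divff// gt_eqF.
rewrite comb (_ : \row_k _ = (\sum_k l 0 k)^-1 *: l).
  by rewrite -!scalemxAl steps_partial_sum xA scaler0.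
by apply/rowP => k; rewrite !mxE mulrC.
Qed.

Lemma card_not_in_conv (R : realType) (n d : nat) (A : 'M[R]_(n, d)) :
  (0 < n)%N -> rationally_generic A ->
  (#|[pred g : signed_perm n | `[< ~ in_conv_hull (signed_walk g A) 0 >]]| +
    rho n (n - d) = 2 ^ n * n`!)%N.
Proof.
move=> n0 gA.
have -> : rho n (n - d) = #|[pred g : signed_perm n |
    `[< exists2 x : 'rV[R]_n, x *m A = 0 & chamber g x >]]|.
  rewrite card_chambers (@eq_nregions _ _ _ _ (relations A 0)).
    rewrite nregions_walls// ?mxrank0 ?addn0// => v; rewrite submx0 => /eqP -> _.
    by [].
  move=> x; split=> [xA|[]//]; split=> //.
  by rewrite map_mx0 trmx0 mulmx0.
rewrite addnC -[X in _ = X](_ : #|signed_perm n| = _); last first.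
  by rewrite card_prod card_ffun card_bool card_ord card_Sn mulnC.
rewrite -(cardC [pred g : signed_perm n | `[< exists2 x : 'rV[R]_n, x *m A = 0 & chamber g x >]]).
congr (_ + _)%N; apply: eq_card => g; rewrite !inE -asbool_neg.
have e := in_conv_signed_walk g n0 gA.
by apply/asboolP/asboolP => h /e.
Qed.

(** * The coefficients B(n, k) *)

(** Here [(d.+1)./2] is the ceiling of d/2, so 2k <= d+1 and the truncated subtraction is exact. *)
Definition alt_Bsum (n d : nat) : int :=
  \sum_(1 <= k < (d.+1)./2.+1) Bcoef n (d.+1 - 2 * k).

Lemma alt_Bsum_step (n d : nat) : alt_Bsum n d.+2 = Bcoef n d.+1 + alt_Bsum n d.
Proof.
rewrite /alt_Bsum /= big_nat_recl//=; congr (_ + _).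
by apply: eq_bigr => k _; congr Bcoef; lia.
Qed.

Lemma alt_Bsum0 (n : nat) : alt_Bsum n 0 = 0.
Proof. by rewrite /alt_Bsum big_geq. Qed.

Lemma alt_Bsum1 (n : nat) : alt_Bsum n 1 = Bcoef n 0.
Proof. by rewrite /alt_Bsum big_nat1. Qed.

Lemma Bcoef0 (k : nat) : Bcoef 0 k = (k == 0%N)%:R.
Proof. by rewrite /Bcoef big_ord0 coef1. Qed.

Lemma BcoefS (n k : nat) : Bcoef n.+1 k =
  (if k is k'.+1 then Bcoef n k' else 0) + (2 * n + 1)%:R * Bcoef n k.
Proof.
rewrite /Bcoef big_ord_recr/= mulrDr coefD coefMX coefMC mulrC.
by case: k.
Qed.

(** [BcoefS] summed over one parity class of indices, hence an induction that descends by two. *)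
Lemma alt_BsumS (n d : nat) : alt_Bsum n.+1 d.+1 =
  alt_Bsum n d + (2 * n + 1)%:R * alt_Bsum n d.+1.
Proof.
have [m] := ubnP d; elim: m d => // m IH [|[|d]] dm.
- by rewrite !alt_Bsum1 alt_Bsum0 BcoefS !add0r.
- by rewrite !alt_Bsum_step !alt_Bsum0 alt_Bsum1 BcoefS !addr0.
rewrite alt_Bsum_step (IH d); last by lia.
by rewrite !(alt_Bsum_step n) BcoefS; ring.
Qed.

(** The polynomial is t + 1, and exactly one of its two coefficients has index of the parity of
    [d]. *)
Lemma alt_Bsum_one (d : nat) : alt_Bsum 1 d.+1 = 1.
Proof.
have [m] := ubnP d; elim: m d => // m IH [|[|d]] dm.
- by rewrite alt_Bsum1 BcoefS !Bcoef0.
- by rewrite alt_Bsum_step alt_Bsum0 BcoefS !Bcoef0.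
by rewrite alt_Bsum_step IH ?BcoefS ?Bcoef0//; lia.
Qed.

Lemma rho_full (p q : nat) : (p <= q)%N -> rho p q = (2 ^ p * p`!)%N.
Proof.
elim: p q => [|p IH] [|q]// pq.
rewrite [LHS]/= !IH ?(ltnW pq)// expnS factS; ring.
Qed.

(** Both terms obey the recursion with coefficients 1 and 2n+1, whose sum 2n+2 is the growth factor
    of 2^n n!. The induction starts at n = 1, since the empty product does not vanish at t = -1. *)
Lemma rho_alt_Bsum (n d : nat) : (0 < n)%N ->
  (rho n (n - d))%:R + 2 * alt_Bsum n d = (2 ^ n * n`!)%:R.
Proof.
case: n => // n _; elim: n d => [|n IH] [|d].
- by rewrite alt_Bsum0.
- by rewrite alt_Bsum_one (_ : (1 - d.+1)%N = 0)//; lia.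
- by rewrite alt_Bsum0 subn0 rho_full// mulr0 addr0.
rewrite alt_BsumS subSS.
have e : (2 ^ n.+2 * (n.+2)`! = (2 * n.+1 + 1).+1 * (2 ^ n.+1 * (n.+1)`!))%N.
  by rewrite expnS factS; ring.
move: e (IH d) (IH d.+1); move: (2 ^ n.+1 * _)%N => F -> h2 h1.
have e2 m : m.+1%:R = 1 + m%:R :> int by rewrite -addn1 natrD addrC.
rewrite natrM (e2 (2 * n.+1 + 1)%N) [in RHS]mulrDl mul1r.
have [dn|dn] := leqP d n.
  have rhoS p q : rho p.+1 q.+1 = (rho p q.+1 + (2 * p + 1) * rho p q)%N by [].
  rewrite subSn// rhoS -subSn//.
  rewrite subSS in h1; rewrite natrD natrM.
  by rewrite -{1}h2 -h1; ring.
(* For d > n both truncated dimensions are 0, where [rho] is 0 instead of following its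
   recursion. *)
have z : (n.+1 - d = 0)%N by apply/eqP; rewrite subn_eq0.
have z' : (n - d = 0)%N by apply/eqP; rewrite subn_eq0 ltnW.
move: h1 h2; rewrite subSS z z' /= !add0r => h1 h2.
by rewrite mulrDr mulrCA h1 h2.
Qed.

(** * Gordan's alternative *)

Definition dot (R : pzRingType) (d : nat) (a x : 'rV[R]_d) : R :=
  \sum_(j < d) a 0 j * x 0 j.

Lemma dotDr (R : pzRingType) (d : nat) (a x y : 'rV[R]_d) :
  dot a (x + y) = dot a x + dot a y.
Proof. by rewrite /dot -big_split; apply: eq_bigr => j _; rewrite mxE mulrDr. Qed.

Lemma dotDl (R : pzRingType) (d : nat) (a b x : 'rV[R]_d) :
  dot (a + b) x = dot a x + dot b x.
Proof. by rewrite /dot -big_split; apply: eq_bigr => j _; rewrite mxE mulrDl. Qed.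

Lemma dotZr (R : comPzRingType) (d : nat) (c : R) (a x : 'rV[R]_d) :
  dot a (c *: x) = c * dot a x.
Proof. by rewrite /dot mulr_sumr; apply: eq_bigr => j _; rewrite mxE mulrCA. Qed.

Lemma dotZl (R : comPzRingType) (d : nat) (c : R) (a x : 'rV[R]_d) :
  dot (c *: a) x = c * dot a x.
Proof. by rewrite /dot mulr_sumr; apply: eq_bigr => j _; rewrite mxE mulrA. Qed.

Lemma dot_sumr (R : pzRingType) (d : nat) (I : finType) (a : 'rV[R]_d)
  (x : I -> 'rV[R]_d) : dot a (\sum_i x i) = \sum_i dot a (x i).
Proof.
rewrite (big_morph (dot a) (dotDr a) (_ : dot a 0 = 0))//.
by rewrite /dot big1// => j _; rewrite mxE mulr0.
Qed.

Lemma dot_gt0 (R : realFieldType) (d : nat) (x : 'rV[R]_d) : x != 0 -> 0 < dot x x.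
Proof.
move=> /rV0Pn[j xj]; rewrite /dot (bigD1 j)//= ltr_pwDl//.
  by rewrite -expr2 exprn_even_gt0.
by rewrite sumr_ge0// => i _; rewrite -expr2 sqr_ge0.
Qed.

(* In the inductive step the vectors [u k] lie in the hyperplane orthogonal
   to [a]. *)
Lemma gordan (R : realFieldType) (d n : nat) (v : 'I_n -> 'rV[R]_d) :
  (exists a, forall k, 0 < dot a (v k)) \/
  (exists l : 'I_n -> R, [/\ forall k, 0 <= l k, exists k, 0 < l k &
     \sum_k l k *: v k = 0]).
Proof.
elim: n v => [|n IH] v; first by left; exists 0; case.
pose v0 := v ord0; pose w k := v (lift ord0 k).
have split_all (P : 'I_n.+1 -> Prop) : P ord0 -> (forall k, P (lift ord0 k)) ->
    forall k, P k.
  by move=> P0 PS k; case: (unliftP ord0 k) => [j|] ->.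
have ext (l0 : R) (l : 'I_n -> R) : 0 <= l0 -> (forall k, 0 <= l k) ->
    (0 < l0 \/ exists k, 0 < l k) -> l0 *: v0 + \sum_k l k *: w k = 0 ->
    exists l : 'I_n.+1 -> R, [/\ forall k, 0 <= l k, exists k, 0 < l k &
     \sum_k l k *: v k = 0].
  move=> h0 h hpos hs; exists (fun k => oapp l l0 (unlift ord0 k)).
  split.
  - by apply: split_all => [|k]; rewrite ?unlift_none ?liftK /=.
  - case: hpos => [l00|[k lk]]; first by exists ord0; rewrite unlift_none.
    by exists (lift ord0 k); rewrite liftK.
  - rewrite big_ord_recl unlift_none -[RHS]hs; congr (_ + _).
    by apply: eq_bigr => k _; rewrite liftK.
case: (IH w) => [[a aw]|[l [l0 lpos ls]]]; last first.
  by right; apply: (ext 0 l) => //; [right|rewrite scale0r add0r].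
have [av0|av0] := ltP 0 (dot a v0).
  by left; exists a; apply: split_all.
have [v00|v00] := eqVneq v0 0.
  right; apply: (ext 1 (fun=> 0)); rewrite ?ler01 ?ltr01//; first by left.
  by rewrite v00 scaler0 add0r big1// => k _; rewrite scale0r.
have [av00|avn0] := eqVneq (dot a v0) 0.
  have [N N0 hN] := large_multiple (fun k => dot a (w k)) (fun k => dot v0 (w k)).
  left; exists (N *: a + v0); apply: split_all => [|k].
    by rewrite dotDl dotZl av00 mulr0 add0r dot_gt0.
  by rewrite dotDl dotZl hN// aw.
have s0 : 0 < - dot a v0 by rewrite oppr_gt0 lt_neqAle avn0.
pose u k := dot a (w k) *: v0 + (- dot a v0) *: w k.
case: (IH u) => [[b bu]|[l [l0 [k lk] ls]]].
  (* [c] vanishes on [v0] and takes on [w k] the value [dot b (u k)]; subtracting a little of [a]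
     makes it positive on [v0] too. *)
  pose c := (- dot a v0) *: b + dot b v0 *: a.
  have cw k : 0 < dot c (w k).
    rewrite dotDl !dotZl; have := bu k; rewrite dotDr !dotZr.
    by rewrite addrC [dot a (w k) * _]mulrC.
  have [N N0 hN] := large_multiple (fun k => dot c (w k)) (fun k => - dot a (w k)).
  left; exists (N *: c + (-1) *: a); apply: split_all => [|k].
    rewrite dotDl !dotZl dotDl !dotZl mulNr [dot b v0 * _]mulrC addNr.
    by rewrite mulr0 add0r mulN1r.
  by rewrite dotDl !dotZl mulN1r hN.
right; apply: (ext (\sum_k l k * dot a (w k)) (fun k => l k * - dot a v0)).
- by rewrite sumr_ge0// => i _; rewrite mulr_ge0// ltW.
- by move=> i; rewrite mulr_ge0// ltW.
- by right; exists k; rewrite mulr_gt0.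
- rewrite -[RHS]ls scaler_suml -big_split; apply: eq_bigr => i _.
  by rewrite scalerDr !scalerA.
Qed.

(** A real separating vector is scaled up until rounding its entries down to integers changes no
    sign. *)
Lemma not_in_conv_hullP (R : realType) (d n : nat) (p : 'I_n -> 'rV[R]_d) :
  ~ in_conv_hull p 0 <->
  exists z : 'rV[int]_d, forall k, 0 < dot (map_mx intr z) (p k).
Proof.
split=> [np|[z zp] [l [l0 [l1 lp]]]]; last first.
  have : dot (map_mx intr z) (\sum_k l k *: p k) = 0.
    by rewrite lp /dot big1// => j _; rewrite [X in _ * X]mxE mulr0.
  rewrite dot_sumr; under eq_bigr do rewrite dotZr.
  move/eqP; rewrite psumr_eq0 => [/allP h|k _]; last by rewrite mulr_ge0// ltW.
  have : \sum_k l k = 0.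
    rewrite big1// => k _; have := h k; rewrite mem_index_enum => /(_ isT).
    by rewrite mulf_eq0 (gt_eqF (zp k)) orbF => /eqP.
  by rewrite l1 => /eqP; rewrite oner_eq0.
case: (gordan p) => [[a ap]|[l [l0 [k lk] lp]]]; last first.
  have s0 : 0 < \sum_i l i.
    by rewrite (bigD1 k)//= ltr_wpDr// sumr_ge0.
  exfalso; apply: np; exists (fun k => l k / \sum_i l i); split.
    by move=> i; rewrite divr_ge0// ltW.
  split; first by rewrite -mulr_suml divff// gt_eqF.
  transitivity ((\sum_i l i)^-1 *: \sum_k l k *: p k); last by rewrite lp scaler0.
  by rewrite scaler_sumr; apply: eq_bigr => i _; rewrite scalerA mulrC.
(* Rounding moves each entry by at most 1, hence the product with [p k] by at most the sum of the
   absolute entries of [p k]. *)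
have [N N0 hN] := large_multiple (fun k => dot a (p k))
  (fun k => - \sum_(j < d) `|p k 0 j|).
exists (\row_j Num.floor (N * a 0 j)) => k.
apply: lt_le_trans (hN k (ap k)) _; rewrite lerBlDr /dot mulr_sumr -big_split.
apply: ler_sum => j _ /=; rewrite !mxE mulrA -lerBlDl -mulrBl.
apply: le_trans (ler_norm _) _; rewrite normrM ler_piMl//.
have /andP[h1 h2] := floor_itv (N * a 0 j).
rewrite ger0_norm ?subr_ge0// lerBlDr addrC -intrD1.
exact: ltW.
Qed.

(** * Laws of random matrices with independent rows *)

(** On this type [measurable] is convertible with [Rd_borel]. *)
Definition vecT (R : realType) (d : nat) := g_sigma_algebraType (@coord_preimages R d).

Definition rectangle (R : realType) (n d : nat) (B : 'I_n -> set 'rV[R]_d) :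
  set 'M[R]_(n, d) := [set A | forall i, B i (row i A)].

Definition rectangles (R : realType) (n d : nat) : set (set 'M[R]_(n, d)) :=
  [set D | exists2 B, (forall i, Rd_borel (B i)) & D = rectangle B].

(** Rectangles generate, because they form the pi-system on which independence prescribes the
    law. *)
Definition matT (R : realType) (n d : nat) := g_sigma_algebraType (@rectangles R n d).

Lemma Rd_borelT (R : realType) (d : nat) : @Rd_borel R d setT.
Proof.
have : measurable [set: vecT R d] by exact: measurableT.
by [].
Qed.

Lemma measurable_rectangle (R : realType) (n d : nat) (B : 'I_n -> set 'rV[R]_d) :
  (forall i, Rd_borel (B i)) -> measurable (rectangle B : set (matT R n d)).
Proof. by move=> mB; apply: sub_sigma_algebra; exists B. Qed.

Lemma probability_rectangle_unique (R : realType) (n d : nat)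
    (P Q : probability (matT R n d) R) :
  (forall B, (forall i, Rd_borel (B i)) -> P (rectangle B) = Q (rectangle B)) ->
  forall D, measurable D -> P D = Q D.
Proof.
move=> PQ D mD; apply: (@measure_unique _ R (matT R n d) (@rectangles R n d) (fun=> setT) _ _ _ _ P Q) => //.
- move=> _ _ [B mB ->] [C mC ->]; exists (fun i => B i `&` C i).
    by move=> i; exact: (@measurableI _ (vecT R d) _ _ (mB i) (mC i)).
  apply/seteqP; split=> A; first by move=> [AB AC] i; split.
  by move=> ABC; split=> i; have [] := ABC i.
- move=> _; exists (fun=> setT); first by move=> _; apply: Rd_borelT.
  by apply/seteqP; split.
- by apply/seteqP; split=> // A _; exists 0%N.
- by move=> _ [B mB ->]; apply: PQ.
- by move=> _; rewrite [ltLHS](@probability_setT _ _ _ P) ltry.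
Qed.

Lemma measurable_coord (R : realType) (d : nat) (j : 'I_d) :
  measurable_fun setT (fun v : vecT R d => v ord0 j).
Proof.
move=> _ A mA; rewrite setTI; apply: sub_sigma_algebra; by exists j, A.
Qed.

Lemma measurable_row (R : realType) (n d : nat) (i : 'I_n) :
  measurable_fun setT (fun A : matT R n d => row i A : vecT R d).
Proof.
move=> _ B mB; rewrite setTI; apply: sub_sigma_algebra.
exists (fun k => if k == i then B else setT).
  by move=> k; case: ifP => // _; apply: Rd_borelT.
apply/seteqP; split=> A /=; first by move=> BA k; case: eqP => // ->.
by move/(_ i); rewrite eqxx.
Qed.

Lemma measurable_entry (R : realType) (n d : nat) (i : 'I_n) (j : 'I_d) :
  measurable_fun setT (fun A : matT R n d => A i j).
Proof.
apply: (eq_measurable_fun (fun A : matT R n d => (row i A) ord0 j)).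
  by move=> A _; rewrite mxE.
apply: (measurableT_comp (f := fun v : vecT R d => v ord0 j)).
  exact: measurable_coord.
exact: measurable_row.
Qed.

Lemma measurable_vec (dT : measure_display) (T : measurableType dT)
  (R : realType) (d : nat) (f : T -> vecT R d) :
  (forall j, measurable_fun setT (fun t => f t ord0 j)) -> measurable_fun setT f.
Proof.
move=> mf; apply: (@measurability _ _ T (vecT R d) setT f (@coord_preimages R d)) => //.
move=> _ [_ [j [A [mA ->]]] <-]; exact: mf.
Qed.

Lemma measurable_mat (dT : measure_display) (T : measurableType dT)
  (R : realType) (n d : nat) (f : T -> matT R n d) :
  (forall i j, measurable_fun setT (fun t => f t i j)) -> measurable_fun setT f.
Proof.
move=> mf; apply: (@measurability _ _ T (matT R n d) setT f (@rectangles R n d)) => //.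
move=> _ [_ [B mB ->] <-]; rewrite setTI.
rewrite (_ : _ @^-1` _ = \bigcap_(i in [set: 'I_n]) ((fun t => row i (f t)) @^-1` B i)).
  apply: fin_bigcap_measurable => // i _; rewrite -[X in measurable X]setTI.
  have : measurable_fun setT (fun t => row i (f t) : vecT R d).
    by apply: measurable_vec => j; apply: eq_measurable_fun (mf i j) => t _; rewrite mxE.
  by move=> /(_ measurableT _ (mB i)).
by apply/seteqP; split=> t /= h i; [move=> _; apply: h|apply: h].
Qed.

Lemma measurable_mulmxl (R : realType) (r n d : nat) (C : 'M[R]_(r, n)) (i : 'I_r)
  (j : 'I_d) : measurable_fun setT (fun A : matT R n d => (C *m A) i j).
Proof.
apply: (eq_measurable_fun (fun A : matT R n d => \sum_k C i k * A k j)).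
  by move=> A _; rewrite mxE.
apply: measurable_sum => k; apply: measurable_funM => //; exact: measurable_entry.
Qed.

(** The Gram determinant is polynomial in the entries, so row-freeness becomes measurable. Over an
    ordered field [v *m M *m M^T = 0] makes the squared length of [v *m M] zero. *)
Lemma row_free_gram (R : realFieldType) (r d : nat) (M : 'M[R]_(r, d)) :
  row_free M = (\det (M *m M^T) != 0).
Proof.
have -> : (\det (M *m M^T) != 0) = row_free (M *m M^T).
  by rewrite row_free_unit unitmxE unitfE.
apply/idP/idP => fM; last first.
  have := mxrankM_maxl M M^T; rewrite (eqP fM) => h.
  by rewrite /row_free eqn_leq rank_leq_row.
rewrite -kermx_eq0; apply/eqP/row_matrixP => i; rewrite row0.
have : row i (kermx (M *m M^T)) *m (M *m M^T) = 0.
  by apply/sub_kermxP; rewrite row_sub.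
set v := row i _; rewrite mulmxA => /(congr1 (mulmx^~ v^T)); rewrite mul0mx -mulmxA.
rewrite -trmx_mul => /matrixP/(_ 0 0); rewrite !mxE => h.
apply/eqP; rewrite -(mulmx_free_eq0 v fM); apply: contra_eqT h => /dot_gt0.
rewrite /dot => h; rewrite gt_eqF//.
by under eq_bigr do rewrite [_^T _ _]mxE.
Qed.

Lemma measurable_row_free (R : realType) (r n d : nat) (C : 'M[R]_(r, n)) :
  measurable [set A : matT R n d | row_free (C *m A)].
Proof.
have mG : measurable_fun setT
    (fun A : matT R n d => \det ((C *m A) *m (C *m A)^T)).
  apply: measurable_sum => s; apply: measurable_funM => //.
  apply: measurable_prod => i _.
  apply: (eq_measurable_fun
    (fun A : matT R n d => \sum_k (C *m A) i k * (C *m A) (s i) k)).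
    by move=> A _; rewrite [RHS]mxE; apply: eq_bigr => k _; congr (_ * _); rewrite [RHS]mxE.
  by apply: measurable_sum => k; apply: measurable_funM; apply: measurable_mulmxl.
rewrite (_ : [set A | _] = (fun A : matT R n d => \det ((C *m A) *m (C *m A)^T))
    @^-1` (~` [set 0])).
  by rewrite -[X in measurable X]setTI; apply: mG => //; apply: measurableC.
by apply/seteqP; split=> A /=; rewrite row_free_gram => /eqP.
Qed.

(** * Product laws, resampling and almost sure row-freeness *)

Definition mfun_of (d1 d2 : measure_display) (T1 : measurableType d1)
  (T2 : measurableType d2) (f : T1 -> T2) (mf : measurable_fun setT f) :
  {mfun T1 >-> T2} := HB.pack f (isMeasurableFun.Build _ _ _ _ f mf).

Definition iid_law (R : realType) (n d : nat) (mu : probability (vecT R d) R)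
  (nu : probability (matT R n d) R) : Prop :=
  forall B : 'I_n -> set 'rV[R]_d, (forall i, Rd_borel (B i)) ->
    nu (rectangle B) = (\prod_(i < n) mu (B i))%E.

Definition replace_row (R : pzRingType) (n d : nat) (j : 'I_n) (A : 'M[R]_(n, d))
  (x : 'rV[R]_d) : 'M[R]_(n, d) :=
  \matrix_(i, k) if i == j then x 0 k else A i k.

(* Resampling one row leaves the law unchanged. *)
Lemma iid_law_replace_row (R : realType) (n d : nat) (mu : probability (vecT R d) R)
    (nu : probability (matT R n d) R) (j : 'I_n) (N : set (matT R n d)) :
  iid_law mu nu -> measurable N ->
  (forall A, mu [set x | N (replace_row j A x)] = 0%E) -> nu N = 0%E.
Proof.
move=> iid mN N0.
have mPhi : measurable_fun setT
    (fun p : matT R n d * vecT R d => replace_row j p.1 p.2 : matT R n d).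
  apply: measurable_mat => i k.
  apply: (eq_measurable_fun (fun p : matT R n d * vecT R d =>
    if i == j then p.2 ord0 k else p.1 i k)); first by move=> p _; rewrite mxE.
  case: (i == j).
    apply: (measurableT_comp (f := fun v : vecT R d => v ord0 k)) => //.
    exact: measurable_coord.
  apply: (measurableT_comp (f := fun A : matT R n d => A i k)) => //.
  exact: measurable_entry.
pose Phi := mfun_of mPhi.
(* On a rectangle, factor [j] comes from the fresh row and the others from [A], which gives the same
   product. *)
have /(_ _ mN) -> : forall D, measurable D -> nu D = distribution (nu \x mu)%E Phi D.
  apply: probability_rectangle_unique => B mB.
  rewrite -[RHS]/((nu \x mu)%E (Phi @^-1` rectangle B)).
  pose B' i := if i == j then setT else B i.
  have mB' i : Rd_borel (B' i).
    by rewrite /B'; case: ifP => // _; apply: Rd_borelT.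
  have -> : Phi @^-1` rectangle B = rectangle B' `*` B j.
    apply/seteqP; split=> -[A x] /=.
      move=> h; split=> [i|]; last first.
        by have := h j; congr B; apply/rowP => k; rewrite !mxE eqxx.
      rewrite /= /B'; case: eqP => // /eqP ij; have := h i; congr B.
      by apply/rowP => k; rewrite !mxE (negbTE ij).
    move=> [/= h Bx] i; have [->|ij] := eqVneq i j.
      by move: Bx; congr B; apply/rowP => k; rewrite !mxE eqxx.
    have := h i; rewrite /B' (negbTE ij); congr B.
    by apply/rowP => k; rewrite !mxE (negbTE ij).
  have mBj : measurable (B j : set (vecT R d)) by exact: mB.
  rewrite [RHS](product_measure1E _ _ (measurable_rectangle mB') mBj).
  rewrite iid// [X in _ = (X * _)%E](iid _ mB') (bigD1 j)//=.
  rewrite [X in _ = (X * _)%E](bigD1 j)//= {1}/B' eqxx.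
  rewrite probability_setT mul1e muleC; congr (_ * _)%E.
  by apply: eq_bigr => i ij; rewrite /B' (negbTE ij).
(* The product measure integrates over [A] the measures of the sections, all of them 0. *)
rewrite /distribution /pushforward /= /product_measure1 integral0_eq// => A _ /=.
rewrite -[RHS](N0 A); congr (mu _); apply/seteqP; split=> x;
by rewrite /xsection/= inE.
Qed.

Lemma measurable_dot (R : realType) (d : nat) (a : 'rV[R]_d) :
  measurable_fun setT (fun x : vecT R d => dot a x).
Proof.
apply: measurable_sum => j; apply: measurable_funM => //; exact: measurable_coord.
Qed.

Lemma replace_rowE (R : comPzRingType) (r n d : nat) (C : 'M[R]_(r, n)) (j : 'I_n)
    (A : 'M[R]_(n, d)) (x : 'rV[R]_d) :
  C *m replace_row j A x = col j C *m x + C *m replace_row j A 0.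
Proof.
apply/matrixP => i k; rewrite !mxE big_ord1 !mxE.
rewrite (bigD1 j)//= [in RHS](bigD1 j)//= !mxE eqxx mulr0 add0r; congr (_ + _).
by apply: eq_bigr => m mj; rewrite !mxE (negbTE mj).
Qed.

(* Eliminating the pivot entry [j] from all rows but the first leaves the law
   of the remaining rows independent of the resampled row [j] of [A], which
   then avoids the hyperplane through their span. *)
Lemma iid_law_row_free (R : realType) (n d : nat) (mu : probability (vecT R d) R)
    (nu : probability (matT R n d) R) :
  iid_law mu nu -> (forall H, affine_hyperplane H -> mu H = 0%E) ->
  forall (r : nat) (C : 'M[R]_(r, n)), row_free C -> (r <= d)%N ->
  nu [set A | ~~ row_free (C *m A)] = 0%E.
Proof.
move=> iid hyp; elim=> [|r IH] C fC rd.
  rewrite (_ : [set A | _] = set0) ?measure0//; apply/seteqP; split=> // A /=.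
  by rewrite /row_free eqn_leq rank_leq_row.
have mbad s (D : 'M[R]_(s, n)) : measurable [set A : matT R n d | ~~ row_free (D *m A)].
  rewrite (_ : [set A | _] = ~` [set A : matT R n d | row_free (D *m A)]).
    by apply: measurableC; exact: measurable_row_free.
  by apply/seteqP; split=> A /= => /negP.
pose c : 'rV[R]_n := @usubmx _ 1 r n C; pose C1 : 'M[R]_(r, n) := @dsubmx _ 1 r n C.
have CE : C = col_mx c C1 by rewrite vsubmxK.
clearbody c C1.
have [j cj] : exists j, c 0 j != 0.
  have rC : \rank C = \rank (c + C1)%MS by rewrite {1}CE addsmxE.
  apply/rV0Pn; apply: contraTneq fC => c0; rewrite /row_free rC c0.
  by rewrite adds0mx neq_ltn ltnS rank_leq_row.
pose v : 'cV[R]_r := (c 0 j)^-1 *: col j C1.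
pose D : 'M[R]_(r, n) := C1 - v *m c.
pose L : 'M[R]_(1 + r) := block_mx 1%:M 0 (- v) 1%:M.
have LC : L *m C = col_mx c D.
  by rewrite CE mul_block_col !mul1mx mul0mx addr0 mulNmx addrC.
have uL : row_full L by rewrite row_full_unit unitmxE det_lblock !det1 mulr1 unitr1.
have Dj : col j D = 0.
  apply/matrixP => i k; rewrite !mxE big_ord1 !mxE mulrAC mulVf// mul1r subrr//.
have fcD : row_free (col_mx c D).
  by rewrite -LC /row_free (eqmxMfull _ uL).
have fD : row_free D.
  move: fcD; rewrite /row_free -addsmxE => /eqP e.
  have := (mxrank_adds_leqif c D).1; rewrite e.
  have := rank_leq_row c; have := rank_leq_row D; lia.
(* What remains after discarding the null set given by induction for [D]. As column [j] of [D] is 0,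
   resampling row [j] leaves [D *m A] unchanged. *)
pose N := [set A : matT R n d | row_free (D *m A)] `&`
          [set A : matT R n d | ~~ row_free (C *m A)].
have mN : measurable N by apply: measurableI; [exact: measurable_row_free|exact: mbad].
have nuN : nu N = 0%E.
  apply: (iid_law_replace_row (j := j) iid mN) => A.
  have [fM|nfM] := boolP (row_free (D *m A)); last first.
    rewrite (_ : [set x | _] = set0) ?measure0//; apply/seteqP; split=> // x [/= + _].
    rewrite (replace_rowE D) Dj mul0mx add0r; move: nfM.
    have -> : D *m A = D *m replace_row j A (row j A).
      by congr (_ *m _); apply/matrixP => i k; rewrite !mxE; case: eqP => // ->.
    by rewrite (replace_rowE D j A (row j A)) Dj mul0mx add0r => /negbTE ->.
  (* As r < d, the rows of [D *m A] lie in a linear hyperplane, with normal [a]. *)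
  have [a a0 aM] : exists2 a : 'rV[R]_d, a != 0 & D *m A *m a^T = 0.
    have : kermx (D *m A)^T != 0.
      rewrite kermx_eq0 /row_free mxrank_tr neq_ltn.
      by rewrite (leq_ltn_trans (rank_leq_row _)).
    move=> /rowV0Pn[a /sub_kermxP ak a0]; exists a => //.
    by rewrite -[LHS]trmxK trmx_mul trmxK ak trmx0.
  pose b := c *m replace_row j A 0.
  (* If c_j x + b, the row given by [c], lies in that hyperplane, then x lies in [H]. *)
  pose H := [set x : 'rV[R]_d | \sum_(k < d) a ord0 k * x ord0 k = - (dot a b / c 0 j)].
  have mH : measurable (H : set (vecT R d)).
    rewrite (_ : H = (fun x : vecT R d => dot a x) @^-1` [set - (dot a b / c 0 j)])//.
    by rewrite -[X in measurable X]setTI; apply: measurable_dot.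
  apply: (@subset_measure0 _ _ _ mu _ H) => //; last first.
  - by apply: hyp; exists a, (- (dot a b / c 0 j)).
  - move=> x [/= fx nfx].
    have Dx : D *m replace_row j A x = D *m A.
      have -> : D *m A = D *m replace_row j A (row j A).
        by congr (_ *m _); apply/matrixP => i k; rewrite !mxE; case: eqP => // ->.
      by rewrite (replace_rowE D j A x) (replace_rowE D j A (row j A)) Dj !mul0mx.
    set X := replace_row j A x in fx nfx Dx.
    have : (c *m X <= D *m A)%MS.
      apply: contraNT nfx => ncX.
      have e : \rank (C *m X) = \rank (c *m X + D *m A)%MS.
        rewrite addsmxE -Dx -mul_col_mx -LC -mulmxA.
        by rewrite (eqmxMfull _ uL).
      have lt : (D *m A < c *m X + D *m A)%MS.
        by rewrite ltmxE addsmxSr/= addsmx_sub submx_refl andbT.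
      rewrite /row_free eqn_leq rank_leq_row e.
      by have := rank_ltmx lt; rewrite (eqP fM).
    move=> /submxP[y yE]; have : c *m X *m a^T = 0 by rewrite yE -mulmxA aM mulmx0.
    rewrite replace_rowE -/b => /matrixP/(_ 0 0); rewrite [RHS]mxE mxE.
    have -> : \sum_k (col j c *m x + b) 0 k * a^T k 0 = c 0 j * dot a x + dot a b.
      rewrite /dot mulr_sumr -big_split; apply: eq_bigr => k _ /=.
      by rewrite !mxE big_ord1 !mxE; ring.
    move=> h; rewrite /H /= -/(dot a x); apply: (mulfI cj).
    by rewrite mulrN mulrCA divff// mulr1; apply/eqP; rewrite -addr_eq0 h.
  - have mr : measurable_fun setT (fun x : vecT R d => replace_row j A x : matT R n d).
      apply: measurable_mat => i k.
      apply: (eq_measurable_fun (fun x : vecT R d => if i == j then x ord0 k else A i k)).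
        by move=> x _; rewrite mxE.
      by case: (i == j) => //; exact: measurable_coord.
    by have := mr measurableT _ mN; rewrite setTI.
have := IH D fD (ltnW rd); set bad := [set A | ~~ row_free (D *m A)] => nuD.
apply: (@subset_measure0 _ _ _ nu _ (bad `|` N)).
- exact: mbad.
- by apply: measurableU => //; exact: mbad.
- move=> A nA; have [fA|nfA] := boolP (row_free (D *m A)); first by right.
  by left.
- by rewrite -[RHS]nuD; apply: (@measureU0 _ _ _ nu) => //; exact: mbad.
Qed.

(** * Invariance of the law under signed permutations *)

Definition signed_act (R : pzRingType) (n d : nat) (g : signed_perm n)
  (A : 'M[R]_(n, d)) : 'M[R]_(n, d) :=
  \matrix_(i, k) ((-1) ^+ g.2 i * A (g.1 i) k).

Lemma measurable_signed_act (R : realType) (n d : nat) (g : signed_perm n) :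
  measurable_fun setT (fun A : matT R n d => signed_act g A : matT R n d).
Proof.
apply: measurable_mat => i k.
apply: (eq_measurable_fun (fun A : matT R n d => (-1) ^+ g.2 i * A (g.1 i) k)).
  by move=> A _; rewrite mxE.
by apply: measurable_funM => //; exact: measurable_entry.
Qed.

Lemma iid_law_signed_act (R : realType) (n d : nat) (mu : probability (vecT R d) R)
    (nu : probability (matT R n d) R) (g : signed_perm n) (N : set (matT R n d)) :
  iid_law mu nu ->
  (forall B, Rd_borel B -> mu B = mu ((fun x : 'rV[R]_d => - x) @^-1` B)) ->
  measurable N -> nu [set A | N (signed_act g A)] = nu N.
Proof.
move=> iid sym mN; pose Phi := mfun_of (@measurable_signed_act R n d g).
rewrite -[LHS]/(distribution nu Phi N); move: N mN.
apply: probability_rectangle_unique => B mB.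
rewrite -[LHS]/(nu (Phi @^-1` rectangle B)).
have mopp : measurable_fun setT (fun x : vecT R d => - x : vecT R d).
  apply: measurable_vec => j.
  apply: (eq_measurable_fun (fun x : vecT R d => - (x ord0 j))).
    by move=> x _; rewrite [RHS]mxE.
  by apply: measurableT_comp => //; exact: measurable_coord.
pose B' k := if g.2 ((g.1^-1)%g k) then (fun x : 'rV[R]_d => - x) @^-1` B ((g.1^-1)%g k)
  else B ((g.1^-1)%g k).
have mB' k : Rd_borel (B' k).
  rewrite /B'; case: ifP => // _.
  by have := mopp measurableT _ (mB ((g.1^-1)%g k)); rewrite setTI.
have -> : Phi @^-1` rectangle B = rectangle B'.
  have rowE A i : row i (signed_act g A) = (-1) ^+ g.2 i *: row (g.1 i) A.
    by apply/rowP => k; rewrite !mxE.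
  apply/seteqP; split=> A /= h i.
    have := h ((g.1^-1)%g i); rewrite rowE permKV /B'.
    by case: (g.2 _) => /=; rewrite ?expr1 ?expr0 ?scaleN1r ?scale1r.
  have := h (g.1 i); rewrite rowE /B' permK.
  by case: (g.2 _) => /=; rewrite ?expr1 ?expr0 ?scaleN1r ?scale1r.
rewrite !iid// (reindex_inj (@perm_inj _ g.1)) /=; apply: eq_bigr => i _.
by rewrite /B' permK; case: (g.2 i) => //; rewrite -sym.
Qed.

(** * The probability *)

(** Rational matrices of all heights form a countable type, so [pickle] indexes the conditions by
    natural numbers. *)
Lemma iid_law_generic (R : realType) (n d : nat) (mu : probability (vecT R d) R)
    (nu : probability (matT R n d) R) :
  iid_law mu nu -> (forall H, affine_hyperplane H -> mu H = 0%E) ->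
  {ae nu, forall A, rationally_generic A}.
Proof.
move=> iid hyp.
pose Q (m : nat) (A : matT R n d) := forall (r : nat) (C : 'M[rat]_(r, n)),
  pickle (Tagged (fun r => 'M[rat]_(r, n)) C) = m -> row_free C -> (r <= d)%N ->
  row_free (map_mx ratr C *m A).
have : {ae nu, forall A, forall m, Q m A}.
  apply: ae_foralln => m.
  have [Qm|] := pselect (forall A, Q m A); first by exists set0; split=> // A /(_ (Qm A)).
  move=> /existsNP[A0 /existsNP[r /existsNP[C /not_implyP[Cm /not_implyP[fC /not_implyP[rd _]]]]]].
  exists [set A | ~~ row_free (map_mx ratr C *m A)]; split.
  - rewrite (_ : [set A | _] = ~` [set A : matT R n d | row_free (map_mx ratr C *m A)]).
      by apply: measurableC; exact: measurable_row_free.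
    by apply/seteqP; split=> A /= => /negP.
  - by apply: (iid_law_row_free iid hyp); rewrite ?row_free_map.
  - move=> A /= nQ; apply/negP => fA; apply: nQ => s E Em.
    move: Em; rewrite -Cm => /(pcan_inj pickleK) e _ _.
    (* [C] and [E] have different types, so the property is transported along the equality of
       dependent pairs. *)
    pose F (u : {r : nat & 'M[rat]_(r, n)}) :=
      row_free (map_mx (ratr : rat -> R) (tagged u) *m (A : 'M[R]_(n, d))).
    by have : F (Tagged _ C) by []; rewrite -e.
apply: filterS => A QA r C fC rd; exact: QA.
Qed.

Definition walk (R : pzRingType) (n d : nat) (A : 'M[R]_(n, d)) (k : 'I_n) :
  'rV[R]_d := \sum_(i < n | (i <= k)%N) row i A.

Lemma walk_signed_act (R : pzRingType) (n d : nat) (g : signed_perm n)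
  (A : 'M[R]_(n, d)) : walk (signed_act g A) = signed_walk g A.
Proof.
apply/funext => k; apply: eq_bigr => i _.
by apply/rowP => j; rewrite !mxE.
Qed.

Lemma measurable_not_in_conv (R : realType) (n d : nat) :
  measurable [set A : matT R n d | ~ in_conv_hull (walk A) 0].
Proof.
rewrite (_ : [set A | _] = \bigcup_(z : 'rV[int]_d) \bigcap_(k in [set: 'I_n])
    [set A : matT R n d | 0 < dot (map_mx intr z) (walk A k)]); last first.
  apply/seteqP; split=> A /=.
    by move=> /not_in_conv_hullP[z zA]; exists z => // k _; apply: zA.
  by move=> [z _ zA]; apply/not_in_conv_hullP; exists z => k; apply: zA.
apply: countable_bigcupT_measurable => // z.
apply: fin_bigcap_measurable => // k _.
rewrite (_ : [set A | _] = (fun A : matT R n d => dot (map_mx intr z) (walk A k))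
  @^-1` `]0, +oo[%classic); last first.
  by apply/seteqP; split=> A /=; rewrite in_itv/= andbT.
rewrite -[X in measurable X]setTI.
have : measurable_fun setT (fun A : matT R n d => dot (map_mx intr z) (walk A k)).
  apply: measurable_sum => j; apply: measurable_funM => //.
  apply: (eq_measurable_fun (fun A : matT R n d => \sum_(i < n | (i <= k)%N) A i j)).
    by move=> A _; rewrite summxE; apply: eq_bigr => i _; rewrite mxE.
  under eq_fun do rewrite big_mkcond.
  by apply: measurable_sum => i; case: (i <= k)%N => //; exact: measurable_entry.
by apply => //; exact: measurable_itv.
Qed.

Lemma iid_law_not_in_conv (R : realType) (n d : nat) (mu : probability (vecT R d) R)
    (nu : probability (matT R n d) R) : (0 < n)%N -> iid_law mu nu ->
  (forall H, affine_hyperplane H -> mu H = 0%E) ->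
  (forall B, Rd_borel B -> mu B = mu ((fun x : 'rV[R]_d => - x) @^-1` B)) ->
  nu [set A : matT R n d | ~ in_conv_hull (walk A) 0] =
    (2 / (2 ^+ n * n`!%:R) * (alt_Bsum n d)%:~R)%:E.
Proof.
move=> n0 iid hyp sym; set E : set (matT R n d) := [set A | _].
have mE : measurable E by exact: measurable_not_in_conv.
pose Eg (g : signed_perm n) := [set A : matT R n d | E (signed_act g A)].
have mEg g : measurable (Eg g).
  by have := @measurable_signed_act R n d g measurableT _ mE; rewrite setTI.
pose m : R := (2 * alt_Bsum n d)%:~R.
have cardE A : rationally_generic A ->
    (\sum_(g : signed_perm n) (\1_(Eg g) A)%:E = m%:E :> \bar R)%E.
  move=> gA; rewrite sumEFin; congr (_%:E).
  have -> : m = #|[pred g : signed_perm n |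
      `[< ~ in_conv_hull (signed_walk g A) 0 >]]|%:R.
    rewrite /m -[RHS]/((_ : nat)%:~R); congr (_%:~R).
    have := rho_alt_Bsum d n0; rewrite -(card_not_in_conv n0 gA) natrD addrC.
    by move/addIr => ->; rewrite natz.
  rewrite -sum1_card natr_sum [RHS]big_mkcond; apply: eq_bigr => g _.
  rewrite indicE inE -walk_signed_act.
  by rewrite /Eg /E; case: asboolP => h; [rewrite mem_set|rewrite memNset].
(* Integrating the almost surely constant number of favourable signed permutations yields the sum of
   their probabilities. *)
have key : (\sum_(g : signed_perm n) nu (Eg g) = m%:E)%E.
  transitivity (\int[nu]_A (\sum_(g : signed_perm n) (\1_(Eg g) A)%:E))%E.
    rewrite ge0_integral_sum//.
      by apply: eq_bigr => g _; rewrite integral_indic// setIT.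
    by move=> g; apply/measurable_EFinP; exact: measurable_indic.
  rewrite (ae_eq_integral (cst m%:E))//.
  - by rewrite integral_cst// [X in (_ * X)%E](@probability_setT _ _ _ nu) mule1.
  - by apply: emeasurable_sum => g; apply/measurable_EFinP; exact: measurable_indic.
  - have [Z [mZ Z0 sub]] := iid_law_generic iid hyp; exists Z; split=> // A nA.
    by apply: sub => gA; apply: nA => _; apply: cardE.
move: key; rewrite (eq_bigr (fun=> nu E)); last first.
  by move=> g _; apply: iid_law_signed_act iid sym mE.
have fE : nu E = (fine (nu E))%:E by rewrite fineK// fin_num_measure.
rewrite fE sumEFin sumr_const => -[e]; congr (_%:E).
have c0 : (2 ^+ n * n`!%:R : R) != 0.
  by rewrite mulf_neq0 ?expf_neq0 ?pnatr_eq0// -lt0n fact_gt0.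
apply: (mulfI c0); rewrite [RHS]mulrA [X in _ = X * _]mulrC divfK//.
rewrite -natrX -natrM mulr_natl.
have -> : (2 ^ n * n`! = #|signed_perm n|)%N.
  by rewrite card_prod card_ffun card_bool card_ord card_Sn mulnC.
by rewrite e /m rmorphM.
Qed.

Theorem theorem1p1 (R : realType) (dT : measure_display) (T : measurableType dT)
  (P : probability T R) (d n : nat) (hd : (1 <= d)%N) (hn : (0 < n)%N)
  (xi : 'I_n -> T -> 'rV[R]_d)
  (xi_rv : forall i, random_vector (xi i))
  (xi_indep : independent_vectors P xi)
  (xi_id : forall i, same_distribution P (xi i) (xi (Ordinal hn)))
  (xi_sym : same_distribution P (xi (Ordinal hn)) (fun w => - xi (Ordinal hn) w))
  (xi_hyp : forall H : set 'rV[R]_d, affine_hyperplane H ->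
              P (xi (Ordinal hn) @^-1` H) = 0%E) :
  let S := fun (w : T) (k : 'I_n) => \sum_(i < n | (i <= k)%N) xi i w in
  P [set w | ~ in_conv_hull (S w) 0] =
  ((2 / (2 ^+ n * (n`!)%:R)) *
     \sum_(1 <= k < (d.+1)./2.+1) (Bcoef n (d.+1 - 2 * k))%:~R)%:E.
Proof.
move=> S.
pose X (w : T) : matT R n d := \matrix_(i, j) xi i w 0 j.
have rowX w i : row i (X w) = xi i w by apply/rowP => j; rewrite !mxE.
have mX : measurable_fun setT X.
  apply: measurable_mat => i j.
  by apply: eq_measurable_fun (xi_rv i j) => w _; rewrite mxE.
have m0 : measurable_fun setT (xi (Ordinal hn) : T -> vecT R d).
  by apply: measurable_vec => j; apply: xi_rv.
pose nu := distribution P (mfun_of mX); pose mu := distribution P (mfun_of m0).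
have iid : iid_law mu nu.
  move=> B mB; rewrite -[LHS]/(P (X @^-1` rectangle B)).
  have -> : X @^-1` rectangle B = \bigcap_(i in [set: 'I_n]) (xi i @^-1` B i).
    apply/seteqP; split=> w /= h i; first by move=> _; have := h i; rewrite rowX.
    by rewrite rowX; apply: h.
  by rewrite xi_indep//; apply: eq_bigr => i _; apply: xi_id.
have := iid_law_not_in_conv hn iid xi_hyp xi_sym.
rewrite -[LHS]/(P (X @^-1` [set A | ~ in_conv_hull (walk A) 0])) => e.
rewrite (_ : [set w | _] = X @^-1` [set A | ~ in_conv_hull (walk A) 0]).
  by rewrite e /alt_Bsum rmorph_sum.
have SE w : S w = walk (X w).
  by apply/funext => k; apply: eq_bigr => i _; rewrite rowX.
by apply/seteqP; split=> w /=; rewrite SE.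
Qed.
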